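(* Suppose that the random cocycle $(\Omega,m,\sigma,\mathcal B_\omega,\tilde{\mathcal L}_{\omega,0})$ is admissible (see context). For each $\omega$ let $(B_{\omega,\xi_{k,\omega}}(p))_k$ be a descending sequence of balls in $[0,1]$ centered at the point $p$ and with radii $\xi_{k+1,\omega}<\xi_{k,\omega}$, such that $$E_{\omega,n}:=\sum_{k=0}^{n-1}\mu_{\sigma^k\omega,0}\big(B_{\sigma^k\omega,\xi_{k,\sigma^k\omega}}(p)\big)\to\infty\quad\text{for }m\text{-a.e. }\omega.$$ Then for $m$-a.e. $\omega$ and $\mu_{\omega,0}$-almost all $x$, $T_\omega^k(x)\in B_{\sigma^k\omega,\xi_{k,\sigma^k\omega}}(p)$ for infinitely many $k$, and $$\frac1{E_{\omega,n}}\#\{0\le k<n:T_\omega^k(x)\in B_{\sigma^k\omega,\xi_{k,\sigma^k\omega}}(p)\}\to1\quad\text{as }n\to\infty.$$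
   Context: $B_{\omega,r}(p)$ denotes the ball of radius $r$ about $p$ in $[0,1]$ (in the fibre over $\omega$); the radii $\xi_{k,\omega}$ depend measurably on $\omega$. **Closed system.** $(\Omega,\mathscr F,m)$ is a probability space, $\sigma:\Omega\to\Omega$ invertible, ergodic, $m$-preserving. Each $T_\omega:[0,1]\to[0,1]$ is surjective, finitely branched, piecewise monotone and nonsingular with respect to $\mathrm{Leb}$, $T_\omega^n=T_{\sigma^{n-1}\omega}\circ\dots\circ T_\omega$; weights $g_{\omega,0}\in \mathrm{BV}$; $\mathcal L_{\omega,0}f(x)=\sum_{y\in T_\omega^{-1}(x)}g_{\omega,0}(y)f(y)$, $g_{\omega,0}^{(n)}=\prod_{j=0}^{n-1}g_{\sigma^j\omega,0}\circ T_\omega^j$. Assume: $\operatorname{ess\,sup}_\omega|T'_\omega|<\infty$ and $\operatorname{ess\,sup}_\omega\sup_y\#T_\omega^{-1}(y)<\infty$; $\operatorname{ess\,sup}_\omega\|g_{\omega,0}\|_{L^\infty(\mathrm{Leb})}<\infty$, $\operatorname{ess\,inf}_\omega\inf g_{\omega,0}>0$; for every subinterval $J$ there is $k(J)$ with $T_\omega^{k(J)}(J)=[0,1]$ for a.e. $\omega$; for some $n'\ge1$, $9\operatorname{ess\,sup}_\omega\|g_{\omega,0}^{(n')}\|_{L^\infty(\mathrm{Leb})}<\operatorname{ess\,inf}_\omega\inf\mathcal L_{\omega,0}^{n'}\mathbf 1$. There are a random probability measure $\{\nu_{\omega,0}\}$ (fibre probability measures, measurable in $\omega$), non-atomic and fully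 supported on $[0,1]$, measurable $\lambda_0:\Omega\to(0,\infty)$ with $\log\lambda_{\omega,0}\in L^1(m)$ and a measurable family $\phi_{\omega,0}>0$ in $\mathrm{BV}$ with $\nu_{\sigma\omega,0}(\mathcal L_{\omega,0}f)=\lambda_{\omega,0}\nu_{\omega,0}(f)$, $\mathcal L_{\omega,0}\phi_{\omega,0}=\lambda_{\omega,0}\phi_{\sigma\omega,0}$, $\nu_{\omega,0}(\phi_{\omega,0})=1$; $\mu_{\omega,0}=\phi_{\omega,0}\nu_{\omega,0}$ is the equivariant family of probability measures. $\tilde{\mathcal L}_{\omega,0}=\lambda_{\omega,0}^{-1}\mathcal L_{\omega,0}$, with $\tilde{\mathcal L}^n_{\omega,0}$ the composition along the orbit. $\mathcal B_\omega$ is the Banach space of ($\nu_{\omega,0}$-classes of) functions of bounded variation on $[0,1]$ with norm $\|f\|_{\mathcal B_\omega}=\mathrm{var}(f)+\nu_{\omega,0}(|f|)$, where $\mathrm{var}$ is the minimal variation over the $\nu_{\omega,0}$-equivalence class. **Admissibility.** The cocycle is admissible if: ($\mathcal C$0) $\sigma$ is a homeomorphism, $T(\omega,x)=(\sigma\omega,T_\omega x)$ is measurable, and $\omega\mapsto T_\omega$ has countable range. ($\mathcal C$1) There is $K$ independent of $\omega$ with $\|\tilde{\mathcal L}_{\omega,0}f\|_{\mathcal B_{\sigma\omega}}\le K\|f\|_{\mathcal B_\omega}$ for all $f\in\mathcal B_\omega$ and $m$-a.e. $\omega$. ($\mathcal C$2) There are $N\in\mathbb N$ and measurable $\tilde\alpha^N,\tilde\beta^N:\Omega\to(0,\infty)$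 with $\int_\Omega\log\tilde\alpha^N\,dm<0$ such that for every $f\in\mathcal B_\omega$ and $m$-a.e. $\omega$, $\|\tilde{\mathcal L}^N_{\omega,0}f\|_{\mathcal B_{\sigma^N\omega}}\le\tilde\alpha^N(\omega)\|f\|_{\mathcal B_\omega}+\tilde\beta^N(\omega)\|f\|_{L^1(\nu_{\omega,0})}$. ($\mathcal C$3) There are $D>0$, $\kappa\in(0,1)$ with $\|\tilde{\mathcal L}^n_{\omega,0}f-\nu_{\omega,0}(f)\phi_{\sigma^n\omega,0}\|_{\mathcal B_{\sigma^n\omega}}\le D\|f\|_{\mathcal B_\omega}\kappa^n$ for all $n$, $f\in\mathcal B_\omega$ and $m$-a.e. $\omega$. ($\mathcal C$4) $\operatorname{ess\,sup}_\omega\|\phi_{\omega,0}\|_{\mathcal B_\omega}<\infty$, $\operatorname{ess\,inf}_\omega\inf\phi_{\omega,0}>0$, and correlations decay exponentially: there is $C>0$ with $|\mu_{\omega,0}((f\circ T_\omega^n)h)-\mu_{\sigma^n\omega,0}(f)\mu_{\omega,0}(h)|\le C\|f\|_{L^\infty(\nu_{\sigma^n\omega,0})}\|h\|_{\mathcal B_\omega}\kappa^n$ for $f,h\in \mathrm{BV}$, $n$ sufficiently large, $m$-a.e. $\omega$. *)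

(* Defs.v *)
From HB Require Import structures.
From mathcomp Require Import all_boot all_order all_algebra.
From mathcomp Require Import all_classical all_reals all_analysis ess_sup_inf.

Set Implicit Arguments.
Unset Strict Implicit.
Unset Printing Implicit Defensive.

Import Order.TTheory GRing.Theory Num.Theory.
Import numFieldTopology.Exports numFieldNormedType.Exports.

Local Open Scope classical_set_scope.
Local Open Scope ring_scope.

(* A sigma-algebra and a topology on one carrier, with no compatibility
   required between them. *)
#[short(type="measurableTopologicalType")]
HB.structure Definition MeasurableTopological d :=
  {T of Measurable d T & Topological T}.

Section unit_interval.
Context {R : realType}.
Implicit Types (f : R -> R) (A : set R).

(* The phase space [0,1] is a subset of [R]: fibre maps, weights and observables
   are total functions on [R], of which only the values on [0,1] matter. *)
Definition I01 : set R := `[0, 1]%classic.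

Definition BV f : Prop := bounded_variation 0 1 f.

(* Norm of L^oo(mu) for a measure [mu] on [0,1]. *)
Definition Linfty (mu : {measure set (measurableTypeR R) -> \bar R}) f : \bar R :=
  Lnorm mu +oo%E (EFin \o (f \_ I01)).

Definition inf01 f : \bar R := ereal_inf [set (f x)%:E | x in I01].

(* Finitely many branches, given by a partition [0 = a_0 < ... < a_n = 1] with
   [f] continuous and strictly monotone on each open interval; the values at the
   points [a_i] are unconstrained. *)
Definition piecewise_monotone f : Prop :=
  exists2 s : seq R, itv_partition 0 1 s &
    forall i, (i < size s)%N ->
      let J := (`]nth 0 (0 :: s) i, nth 0 s i[) in
      {in J, continuous f} /\
      ({in J &, {homo f : x y / x < y}} \/ {in J &, {homo f : x y /~ x < y}}).

Definition nonsingular f : Prop :=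
  forall A : set (measurableTypeR R),
    measurable A -> A `<=` I01 -> lebesgue_measure A = 0%E ->
    lebesgue_measure (I01 `&` f @^-1` A) = 0%E.

Definition fibre_ball (p r : R) : set R := ball p r `&` I01.

End unit_interval.

(* [orbit_comp sigma F n w] is
   [F (sigma^(n-1) w) \o ... \o F (sigma w) \o F w]. *)
Fixpoint orbit_comp {W X : Type} (sigma : W -> W) (F : W -> X -> X)
    (n : nat) (w : W) (x : X) : X :=
  if n is n'.+1 then F (iter n' sigma w) (orbit_comp sigma F n' w x) else x.

(* base = sigma, fibre_map = T, weight = g_0, conf = nu_0, eigv = lambda_0,
   dens = phi_0. *)
Record cocycle (R : realType) (d : measure_display)
    (W : measurableTopologicalType d) := Cocycle {
  base : W -> W ;
  fibre_map : W -> R -> R ;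
  weight : W -> R -> R ;
  conf : R.-pker W ~> measurableTypeR R ;
  eigv : W -> R ;
  dens : W -> R -> R
}.

Section cocycle_operators.
Context {R : realType} {d : measure_display} {W : measurableTopologicalType d}.
Variable S : cocycle R W.
Implicit Types (w : W) (f : R -> R) (n : nat).

Definition sigma_iter n w : W := iter n (base S) w.

Definition fibre_iter n w (x : R) : R := orbit_comp (base S) (fibre_map S) n w x.

Definition weight_iter n w (x : R) : R :=
  \prod_(j < n) weight S (sigma_iter j w) (fibre_iter j w x).

Definition fibre_preimage w (x : R) : set R := I01 `&` fibre_map S w @^-1` [set x].

(* A sum with finite support, as the maps are piecewise strictly monotone with
   finitely many branches. *)
Definition transfer w f (x : R) : R :=
  \sum_(y \in fibre_preimage w x) weight S w y * f y.

Definition transfer_iter n w f : R -> R := orbit_comp (base S) transfer n w f.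

Definition normalized_transfer w f (x : R) : R :=
  (eigv S w)^-1 * transfer w f x.

Definition normalized_transfer_iter n w f : R -> R :=
  orbit_comp (base S) normalized_transfer n w f.

Definition conf_int w f : R := (\int[conf S w]_(x in I01) f x)%R.

(* The measure [phi_w nu_w]. *)
Definition equi w (A : set (measurableTypeR R)) : \bar R :=
  (\int[conf S w]_(x in A `&` I01) (dens S w x)%:E)%E.

Definition equi_int w f : R := fine (\int[equi w]_(x in I01) (f x)%:E)%E.

Definition var w f : \bar R :=
  ereal_inf [set total_variation 0 1 h |
             h in [set h : R -> R | h = f %[ae conf S w in I01]]].

Definition L1norm w f : \bar R := (\int[conf S w]_(x in I01) `|f x|%R%:E)%E.

(* The elements of [B_w] are classes of BV functions: below, quantification over
   [B_w] is quantification over BV representatives. *)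
Definition Bnorm w f : \bar R := (var w f + L1norm w f)%E.

End cocycle_operators.

Section hypotheses.
Context {R : realType} {d : measure_display} {W : measurableTopologicalType d}.
Variables (m : probability W R) (S : cocycle R W).

Record invertible_ergodic (sigma : W -> W) : Prop := InvertibleErgodic {
  ie_measurable : measurable_fun setT sigma ;
  ie_invertible : exists tau : W -> W,
    [/\ cancel sigma tau, cancel tau sigma & measurable_fun setT tau] ;
  ie_preserving : forall A, measurable A -> m (sigma @^-1` A) = m A ;
  ie_ergodic : forall A, measurable A -> sigma @^-1` A = A ->
    m A = 0%E \/ m A = 1%E
}.

Definition homeomorphism (sigma : W -> W) : Prop :=
  exists tau : W -> W,
    [/\ cancel sigma tau, cancel tau sigma, continuous sigma & continuous tau].

Record closed_system : Prop := ClosedSystem {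
  cs_base : invertible_ergodic (base S) ;
  cs_surjective : forall w, fibre_map S w @` I01 = I01 ;
  cs_monotone : forall w, piecewise_monotone (fibre_map S w) ;
  cs_nonsingular : forall w, nonsingular (fibre_map S w) ;
  cs_weight_BV : forall w, BV (weight S w) ;
  (* The derivative of a piecewise monotone map exists Lebesgue-a.e. *)
  cs_derivative :
    (ess_sup m (fun w => Linfty lebesgue_measure (derive1 (fibre_map S w)))
     < +oo)%E ;
  cs_degree : (ess_sup m (fun w => ereal_sup
                 [set counting (fibre_preimage S w y) | y in I01]) < +oo)%E ;
  cs_weight_sup : (ess_sup m (fun w => Linfty lebesgue_measure (weight S w))
                   < +oo)%E ;
  cs_weight_inf : (0 < ess_inf m (fun w => inf01 (weight S w)))%E ;
  cs_covering : forall J : set R, is_interval J -> J `<=` I01 ->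
    (exists x y, [/\ J x, J y & x < y]) ->
    exists k, \forall w \ae m, fibre_iter S k w @` J = I01 ;
  cs_gap : exists2 n', (1 <= n')%N &
    (9%:E * ess_sup m (fun w => Linfty lebesgue_measure (weight_iter S n' w))
     < ess_inf m (fun w => inf01 (transfer_iter S n' w (cst 1%R))))%E ;
  cs_conf_supported : forall w, conf S w I01 = 1%E ;
  cs_conf_nonatomic : \forall w \ae m, forall x, conf S w [set x] = 0%E ;
  cs_conf_full : \forall w \ae m, forall U : set R, open U ->
    U `&` I01 !=set0 -> (0 < conf S w (U `&` I01))%E ;
  cs_eigv_measurable : measurable_fun setT (eigv S) ;
  cs_eigv_gt0 : forall w, 0 < eigv S w ;
  cs_eigv_L1 : m.-integrable setT (fun w => (ln (eigv S w))%:E) ;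
  cs_dens_measurable : measurable_fun (setT `*` I01)
    (fun z : W * R => dens S z.1 z.2) ;
  cs_dens_BV : \forall w \ae m, BV (dens S w) ;
  cs_dens_gt0 : \forall w \ae m, forall x, I01 x -> 0 < dens S w x ;
  cs_conformal : \forall w \ae m, forall f, BV f ->
    conf_int S (base S w) (transfer S w f) = eigv S w * conf_int S w f ;
  cs_eigenfunction : \forall w \ae m,
    transfer S w (dens S w) = (fun x => eigv S w * dens S (base S w) x)
      %[ae conf S (base S w) in I01] ;
  cs_dens_normalized : \forall w \ae m, conf_int S w (dens S w) = 1 ;
  cs_equivariant : \forall w \ae m,
    forall A : set (measurableTypeR R), measurable A -> A `<=` I01 ->
    equi S w (I01 `&` fibre_map S w @^-1` A) = equi S (base S w) A
}.

Record admissible_C0 : Prop := AdmissibleC0 {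
  C0_homeo : homeomorphism (base S) ;
  C0_measurable : measurable_fun (setT `*` I01)
    (fun z : W * R => (base S z.1, fibre_map S z.1 z.2)) ;
  C0_countable : countable (range (fun w => fibre_map S w \_ I01))
}.

Definition admissible_C1 : Prop := exists K : R,
  \forall w \ae m, forall f, BV f ->
    (Bnorm S (base S w) (normalized_transfer S w f) <= K%:E * Bnorm S w f)%E.

(* The condition on the positive part says that the integral of [ln alpha] is
   well defined in [-oo, +oo[, excluding the convention +oo - oo = -oo. *)
Definition admissible_C2 : Prop :=
  exists (N : nat) (alpha beta : W -> R),
    [/\ measurable_fun setT alpha, measurable_fun setT beta,
        forall w, 0 < alpha w /\ 0 < beta w,
        (\int[m]_w ((fun v => (ln (alpha v))%:E)^\+ w) < +oo)%E /\
        (\int[m]_w (ln (alpha w))%:E < 0)%E &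
        \forall w \ae m, forall f, BV f ->
          (Bnorm S (sigma_iter S N w) (normalized_transfer_iter S N w f)
           <= (alpha w)%:E * Bnorm S w f + (beta w)%:E * L1norm S w f)%E].

Definition admissible_C3 (kappa : R) : Prop := exists2 D : R, 0 < D &
  \forall w \ae m, forall n f, BV f ->
    (Bnorm S (sigma_iter S n w)
       (fun x => normalized_transfer_iter S n w f x
                 - conf_int S w f * dens S (sigma_iter S n w) x)%R
     <= D%:E * Bnorm S w f * (kappa ^+ n)%R%:E)%E.

(* [C] is uniform, whereas the threshold on [n] may depend on [w], [f], [h]. *)
Definition decay_of_correlations (kappa : R) : Prop := exists2 C : R, 0 < C &
  \forall w \ae m, forall f h, BV f -> BV h -> \forall n \near \oo,
    (`|equi_int S w (fun x => f (fibre_iter S n w x) * h x)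
       - equi_int S (sigma_iter S n w) f * equi_int S w h|%R%:E
     <= C%:E * Linfty (conf S (sigma_iter S n w)) f * Bnorm S w h
        * (kappa ^+ n)%R%:E)%E.

Definition admissible_C4 (kappa : R) : Prop :=
  [/\ (ess_sup m (fun w => Bnorm S w (dens S w)) < +oo)%E,
      (0 < ess_inf m (fun w => inf01 (dens S w)))%E &
      decay_of_correlations kappa].

Definition admissible : Prop :=
  [/\ admissible_C0, admissible_C1, admissible_C2 &
      exists kappa : R,
        [/\ 0 < kappa < 1, admissible_C3 kappa & admissible_C4 kappa]].

End hypotheses.

Section shrinking_targets.
Context {R : realType} {d : measure_display} {W : measurableTopologicalType d}.
Variables (S : cocycle R W) (p : R) (xi : nat -> W -> R).

(* The target at time [k] along the orbit of [w]: radius xi_{k, sigma^k w}. *)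
Definition target (w : W) (k : nat) : set R :=
  fibre_ball p (xi k (sigma_iter S k w)).

Definition expected_hits (w : W) (n : nat) : R :=
  \sum_(0 <= k < n) fine (equi S (sigma_iter S k w) (target w k)).

Definition hit (w : W) (x : R) (k : nat) : Prop :=
  target w k (fibre_iter S k w x).

Definition hits (w : W) (x : R) (n : nat) : nat :=
  #|[pred k : 'I_n | `[< hit w x k >]]|.

End shrinking_targets.

(* Main.v *)
Require Import Defs.
From HB Require Import structures.
From mathcomp Require Import all_boot all_order all_algebra.
From mathcomp Require Import all_classical all_reals all_analysis ess_sup_inf.
From mathcomp Require Import measurable_realfun ring lra.

(** Why the orbit visits the shrinking balls as often as its mean predicts.

    Fix a fibre w and write X_k(x) for the indicator that T_w^k x lies in the
    k-th target, p_k for its mean under mu_w, and E_n = p_0 + ... + p_(n-1).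
    The count of visits X_0 + ... + X_(n-1) has mean E_n, so the point is a
    variance bound of order E_n; the almost sure statement then follows by the
    classical sparse-subsequence argument.

    The variance bound rests on decorrelation of two visits [i < j]. Moving
    along the orbit to the fibre v = sigma^i w, the mean of X_i X_j is
    mu_v(1_A (1_B o T_v^n)) with n = j - i and A, B intervals. By conformality
    of nu this equals the nu-integral of 1_B against the n-th normalized
    transfer of phi_v 1_A ([transfer_iter_dual]). The spectral gap says that this
    transfer is p_i phi plus an error of size kappa^n in the BV norm, hence
    in the supremum norm; the BV norm of phi_v 1_A is bounded uniformly because
    the indicator of an interval has variation at most 2, however short it is
    ([Bnorm_indicM]). As phi is bounded below, integrating the error over B
    costs at most a constant times kappa^n p_j ([target_decorrelation]): the
    factor p_j is what makes the covariances sum to O(E_n) ([variance_le]).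
    The spectral gap is uniform in the observables, which matters because the
    targets change with time.

    Given the variance bound, choose t_k as the first time at which E reaches
    (k+1)^2. The squared deviations at these times, divided by (k+1)^4, have
    summable means, hence tend to 0 almost everywhere
    ([ae_cvg0_of_summable_integrals]); monotonicity of the count and of E fills
    the gaps between t_k and t_(k+1) ([ratio_cvg1]).

    Conformality is only known for functions of bounded variation, so everything
    must be kept inside that class: observables composed with a fibre map and
    transfers of observables are again of bounded variation, because on each of
    the finitely many branches they are a BV function composed with a monotone
    map and cut off outside an interval ([BV_comp], [fibre_sum_BV]). *)

Set Implicit Arguments.
Unset Strict Implicit.
Unset Printing Implicit Defensive.

Import Order.TTheory GRing.Theory Num.Theory.
Import numFieldTopology.Exports numFieldNormedType.Exports.

Local Open Scope classical_set_scope.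
Local Open Scope ring_scope.
(** * Functions of bounded variation on the unit interval *)

Section bounded_variation_on_unit_interval.
Context {R : realType}.
Implicit Types (f g u v : R -> R) (J : set R).
Local Notation TV := (total_variation (0 : R) 1).

Lemma I01E (x : R) : I01 x <-> 0 <= x <= 1.
Proof. by rewrite /I01 /= in_itv. Qed.

Lemma nondecreasing_BV u :
  (forall x y, I01 x -> I01 y -> x <= y -> u x <= u y) -> BV u.
Proof.
move=> hu; apply: nondecreasing_bounded_variation => x y xI yI.
by apply: hu.
Qed.

Lemma BVD f g : BV f -> BV g -> BV (f \+ g).
Proof. by apply: bounded_variationD. Qed.

Lemma BVB f g : BV f -> BV g -> BV (f \- g).
Proof. by move=> hf /bounded_variationN; exact: BVD. Qed.

(** The Jordan decomposition on [0,1], precomposed with the retraction of the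
    line onto [0,1] so that both parts are monotone everywhere. *)
Lemma BV_jordan f : BV f -> exists u v,
  [/\ nondecreasing_fun u, nondecreasing_fun v &
      forall x, I01 x -> f x = u x - v x].
Proof.
move=> bvf.
pose clamp (x : R) : R := Num.min 1 (Num.max 0 x).
have cI x : clamp x \in `[0, 1].
  by rewrite in_itv /clamp /= le_min ler01 le_max lexx /= ge_min lexx.
have cmono : {homo clamp : x y / x <= y}.
  by move=> x y xy; rewrite /clamp le_min2// le_max2.
have cid x : I01 x -> clamp x = x.
  by move=> /I01E /andP[x0 x1]; rewrite /clamp max_r// min_r.
exists ((fine \o pos_tv 0 f) \o clamp), ((fine \o neg_tv 0 f) \o clamp); split.
- move=> x y xy; apply: (fine_neg_tv_nondecreasing (bounded_variationN bvf)) => //.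
  exact: cmono.
- move=> x y xy; apply: (fine_neg_tv_nondecreasing bvf) => //.
  exact: cmono.
- move=> x xI; rewrite (bounded_variation_pos_neg_tvE bvf) /=; last first.
    by rewrite -(cid _ xI).
  by rewrite cid.
Qed.

Lemma eq_variation f g (s : seq R) : itv_partition 0 1 s ->
  (forall x, I01 x -> f x = g x) ->
  variation 0 1 f s = variation 0 1 g s.
Proof.
move=> ps fg; rewrite /variation !big_nat; apply: eq_bigr => i /andP[_ si].
have pI k : (k < (size s).+1)%N -> I01 (nth 1 (0 :: s) k).
  by move=> ks; apply/I01E; rewrite (itv_partition_nth_ge ks ps)
    (itv_partition_nth_le ks ps).
rewrite /= (fg _ (pI i.+1 si)) (fg _ (pI i _))//.
by rewrite ltnW.
Qed.

Lemma eq_BV f g : (forall x, I01 x -> f x = g x) -> BV f -> BV g.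
Proof.
move=> fg [M hM]; exists M => _ [s ps <-].
by rewrite -(eq_variation ps fg); apply: hM; exists s.
Qed.

Lemma BV_cst (c : R) : BV (cst c).
Proof. by apply: nondecreasing_BV. Qed.

Lemma TV_oscillation f (x y : R) : I01 x -> I01 y ->
  (`|f x - f y|%:E <= TV f)%E.
Proof.
wlog xy : x y / x <= y => [H xI yI|xI yI].
  by have [|/ltW] := leP x y => ?; [|rewrite distrC]; exact: H.
move: xI yI => /I01E /andP[x0 x1] /I01E /andP[y0 y1].
rewrite (total_variationD f x0 x1) (total_variationD f xy y1).
rewrite distrC; apply: (le_trans (total_variation_ge f xy)).
by rewrite addeCA leeDl// adde_ge0// total_variation_ge0.
Qed.

Lemma BV_fin f : BV f <-> TV f \is a fin_num.
Proof. exact: bounded_variationP. Qed.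

Lemma BV_bounded f : BV f -> exists2 M, 0 <= M & forall x, I01 x -> `|f x| <= M.
Proof.
move=> /BV_fin Tf; have I0 : I01 (0 : R) by apply/I01E; rewrite lexx ler01.
exists (`|f 0| + fine (TV f)) => [|x xI].
  by rewrite addr_ge0// fine_ge0// total_variation_ge0.
have := TV_oscillation f xI I0; rewrite -(fineK Tf) lee_fin => h.
rewrite -(subrK (f 0) (f x)) (le_trans (ler_normD _ _))// addrC lerD2l//.
Qed.

(** The discrete Leibniz rule, applied to each increment of a partition. *)
Lemma TVM f g (a b : R) : BV f -> BV g ->
  (forall x, I01 x -> `|f x| <= a) -> (forall x, I01 x -> `|g x| <= b) ->
  (TV (f \* g)%R <= a%:E * TV g + b%:E * TV f)%E.
Proof.
move=> bf bg fa gb.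
have I0 : I01 (0 : R) by apply/I01E; rewrite lexx ler01.
have a0 : 0 <= a by apply: le_trans (fa _ I0).
have b0 : 0 <= b by apply: le_trans (gb _ I0).
have /BV_fin Tf := bf; have /BV_fin Tg := bg.
apply: ge_ereal_sup => _ [_ [s ps <-] <-].
apply: (@le_trans _ _ (a * variation 0 1 g s + b * variation 0 1 f s)%:E).
  rewrite lee_fin /variation !mulr_sumr -big_split/= !big_nat.
  apply: ler_sum => i /andP[_ si].
  have pI k : (k < (size s).+1)%N -> I01 (nth 1 (0 :: s) k).
    by move=> ks; apply/I01E; rewrite (itv_partition_nth_ge ks ps)
      (itv_partition_nth_le ks ps).
  have yI := pI i.+1 si; have xI : I01 (nth 1 (0 :: s) i).
    by apply: pI; rewrite ltnW.
  rewrite /= in yI *; set x := nth 1 (0 :: s) i in xI *; set y := nth 1 s i in yI *.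
  rewrite (_ : f y * g y - f x * g x = f y * (g y - g x) + g x * (f y - f x));
    last by ring.
  rewrite (le_trans (ler_normD _ _))// !normrM lerD// ler_wpM2r//.
    exact: fa.
  exact: gb.
rewrite EFinD; apply: leeD; rewrite EFinM lee_pmul//;
  rewrite ?lee_fin ?variation_ge0//;
  by apply: ereal_sup_ubound; eexists; last reflexivity; exists s.
Qed.

Lemma BVM f g : BV f -> BV g -> BV (f \* g).
Proof.
move=> bf bg; have [a _ fa] := BV_bounded bf; have [b _ gb] := BV_bounded bg.
apply/BV_fin; rewrite ge0_fin_numE ?total_variation_ge0//.
apply: (le_lt_trans (TVM bf bg fa gb)).
have /BV_fin Tf := bf; have /BV_fin Tg := bg.
by rewrite -(fineK Tf) -(fineK Tg) -!EFinM -EFinD ltry.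
Qed.

Lemma BVZ (c : R) f : BV f -> BV (fun x => c * f x).
Proof. by move=> bf; exact: (BVM (BV_cst c) bf). Qed.

Lemma BV_sum (n : nat) (F : nat -> R -> R) : (forall i, (i < n)%N -> BV (F i)) ->
  BV (fun x => \sum_(i < n) F i x).
Proof.
elim: n => [|n ih] hF.
  by apply: (eq_BV _ (BV_cst 0)) => x _; rewrite big_ord0.
have := BVD (ih (fun i h => hF i (ltnW h))) (hF n (ltnSn n)).
by apply: eq_BV => x _; rewrite big_ord_recr.
Qed.

(** An interval is the difference of two up-sets, itself together with what lies
    above it and what lies above it alone; indicators of up-sets are
    nondecreasing. *)
Definition strictly_above J : set R := [set x | ~ J x /\ exists2 y, J y & y <= x].

Lemma strictly_above_up J x y : is_interval J ->
  strictly_above J x -> x <= y -> strictly_above J y.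
Proof.
move=> iJ [nJx [z Jz zx]] xy; split; last by exists z => //; exact: le_trans xy.
by move=> Jy; apply: nJx; apply: (iJ z y) => //; rewrite zx.
Qed.

(** The bound does not see the length of the interval, which is what makes
    estimates on shrinking targets uniform. *)
Lemma TV_indic J : is_interval J -> (TV \1_J <= 2%:E)%E.
Proof.
move=> iJ; pose A := strictly_above J; pose U := J `|` A.
have upA x y : A x -> x <= y -> A y by exact: strictly_above_up.
have upU x y : U x -> x <= y -> U y.
  move=> [Jx|Ax] xy; last by right; exact: upA xy.
  have [Jy|nJy] := pselect (J y); first by left.
  by right; split => //; exists x.
have mono (B : set R) : (forall x y, B x -> x <= y -> B y) ->
    {in `[0, 1] &, nondecreasing_fun (\1_B : R -> R)}.
  move=> upB x y _ _ xy; rewrite !indicE.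
  have [/set_mem Bx|] := boolP (x \in B); last by rewrite ler_nat.
  by rewrite mem_set//; exact: upB xy.
rewrite (_ : \1_J = (\1_U \+ \- \1_A)%R); last first.
  apply/funext => x /=; rewrite !indicE in_setU.
  have [/set_mem Jx|nJx] := boolP (x \in J); last by rewrite orFb subrr.
  by rewrite memNset ?subr0// => -[].
apply: (le_trans (total_variation_le _ _ _)) => //.
have TV1 (B : set R) : (forall x y, B x -> x <= y -> B y) ->
    (TV (\1_B : R -> R) <= 1)%E.
  move=> /mono mB; rewrite nondecreasing_total_variation// lee_fin !indicE.
  by case: (_ \in _); case: (_ \in _) => /=; lra.
by rewrite total_variationN -[2]/(1 + 1) EFinD leeD// TV1.
Qed.

Lemma BV_indic J : is_interval J -> BV \1_J.
Proof.
move=> iJ; apply/BV_fin; rewrite ge0_fin_numE ?total_variation_ge0//.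
by rewrite (le_lt_trans (TV_indic iJ))// ltry.
Qed.

Definition cutoff J f : R -> R := fun x => if x \in J then f x else 0.

(** Shifted by a bound [M], the function extends from the interval to a
    nondecreasing function, equal to 0 on its left and to [2 M] on its right;
    the shift itself, cut off in the same way, is subtracted afterwards. *)
Lemma BV_cutoff_nondecreasing u J (M : R) : is_interval J ->
  (forall x y, I01 x -> I01 y -> J x -> J y -> x <= y -> u x <= u y) ->
  (forall x, I01 x -> J x -> `|u x| <= M) -> BV (cutoff J u).
Proof.
move=> iJ hu hM; pose A := strictly_above J.
pose lift x := if x \in J then u x + M else if x \in A then M + M else 0.
pose base x := if x \in J then M else if x \in A then M + M else 0.
have bd x : I01 x -> J x -> 0 <= u x + M <= M + M.
  by move=> xI /hM-/(_ xI); rewrite ler_norml => /andP[? ?]; lra.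
have aboveA x y : J x -> x <= y -> (y \in J) = false -> y \in A.
  move=> Jx xy /negbT nJy; apply/mem_set; split; last by exists x.
  by move/mem_set; exact/negP.
have upA x y : x \in A -> x <= y -> (y \in J) = false /\ (y \in A).
  move=> /set_mem Ax xy; have Ay := strictly_above_up iJ Ax xy.
  by rewrite (mem_set Ay); split => //; apply/negP => /set_mem; case: Ay.
have mono (w : R -> R) : (forall x, I01 x -> J x -> 0 <= w x <= M + M) ->
   (forall x y, I01 x -> I01 y -> J x -> J y -> x <= y -> w x <= w y) ->
   0 <= M -> BV (fun x => if x \in J then w x else if x \in A then M + M else 0).
  move=> w0 wm M0; apply: nondecreasing_BV => x y xI yI xy.
  have [Jx|nJx] := boolP (x \in J).
    have [Jy|/negbTE nJy] := boolP (y \in J); first by apply: wm => //; exact: set_mem.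
    rewrite (aboveA x)//; last exact: set_mem.
    by have /andP[] := w0 _ xI (set_mem Jx).
  have [Ax|nAx] := boolP (x \in A); first by have [-> ->] := upA _ _ Ax xy.
  case: ifP => [/set_mem Jy|_]; first by have /andP[] := w0 _ yI Jy.
  by case: ifP => // _; rewrite addr_ge0.
have [[x0 xI0 Jx0]|noJ] := pselect (exists2 x, I01 x & J x); last first.
  apply: eq_BV (BV_cst 0) => x xI; rewrite /cutoff memNset// => Jx.
  by apply: noJ; exists x.
have M0 : 0 <= M by exact: le_trans (hM _ xI0 Jx0).
have BVl : BV lift.
  by apply: mono => // x y xI yI Jx Jy xy; rewrite lerD2r hu.
have BVb : BV base by apply: mono => // x _ _; rewrite M0 lerDl.
apply: eq_BV (BVB BVl BVb) => x _ /=; rewrite /lift /base /cutoff.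
by case: (x \in J); [rewrite addrK|rewrite subrr].
Qed.

Definition monotone_on (A : set R) (s : R -> R) : Prop :=
  (forall x y, A x -> A y -> x <= y -> s x <= s y) \/
  (forall x y, A x -> A y -> x <= y -> s y <= s x).

Lemma BV_comp_monotone f s J : BV f -> is_interval J ->
  monotone_on (I01 `&` J) s -> (forall x, I01 x -> J x -> I01 (s x)) ->
  BV (cutoff J (f \o s)).
Proof.
move=> bf iJ ms sI; have [u [v [um vm fE]]] := BV_jordan bf.
have key (w : R -> R) : nondecreasing_fun w -> BV (cutoff J (w \o s)).
  move=> wm; pose M : R := `|w 0| + `|w 1|.
  have bd x : I01 x -> J x -> `|w (s x)| <= M.
    move=> xI Jx; have /I01E/andP[s0 s1] := sI _ xI Jx.
    have := wm _ _ s0; have := wm _ _ s1; rewrite /M /= => h1 h0.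
    have := ler_norm (w 1); have := ler_norm (- w 0).
    have := normr_ge0 (w 1); have := normr_ge0 (w 0); rewrite normrN ler_norml.
    by move=> *; apply/andP; split; lra.
  have [ms'|ms'] := ms.
    apply: (BV_cutoff_nondecreasing iJ _ bd) => x y xI yI Jx Jy xy.
    by apply: wm; exact: ms'.
  have : BV (cutoff J (\- (w \o s))).
    apply: (@BV_cutoff_nondecreasing _ _ M) => // [x y xI yI Jx Jy xy|x xI Jx].
      by rewrite /= lerN2; apply: wm; exact: ms'.
    by rewrite normrN; exact: bd.
  move=> /bounded_variationN; apply: eq_BV => x _.
  by rewrite /cutoff /=; case: (x \in J); rewrite ?opprK ?oppr0.
apply: eq_BV (BVB (key _ um) (key _ vm)) => x xI /=.
rewrite /cutoff; case: ifPn => [/set_mem Jx|_]; last by rewrite subrr.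
by rewrite /= fE//; exact: sI.
Qed.

Lemma BV_measurable f : BV f -> measurable_fun (I01 : set (measurableTypeR R)) f.
Proof.
move=> /BV_jordan[u [v [um vm fE]]].
have mI : measurable (I01 : set (measurableTypeR R)) by exact: measurable_itv.
apply: (eq_measurable_fun (u \- v)) => [x /set_mem xI|]; first by rewrite fE.
by apply: measurable_funB; exact: nondecreasing_measurable.
Qed.

End bounded_variation_on_unit_interval.

(** * Piecewise monotone maps preserve bounded variation *)

Section piecewise_monotone_maps.
Context {R : realType}.
Implicit Types (f T : R -> R) (C : set R).

(** A point is a degenerate branch, so that the endpoints of a monotonicity
    partition, where the value of the map is arbitrary, need no separate
    treatment. *)
Definition branch T C : Prop :=
  [/\ C `<=` I01, is_interval C, is_interval (T @` C) &
      {in C &, {homo T : x y / x < y}} \/ {in C &, {homo T : x y /~ x < y}}].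

Lemma branch_point T (a : R) : I01 a -> branch T [set a].
Proof.
move=> aI; split.
- by move=> _ ->.
- move=> x y -> -> z; rewrite -eq_le => /eqP <-//.
- rewrite image_set1 => x y -> -> z; rewrite -eq_le => /eqP <-//.
- by left => x y; rewrite !inE => -> ->; rewrite ltxx.
Qed.

Lemma branch_itv T (a b : R) : 0 <= a -> b <= 1 ->
  {in `]a, b[, continuous T} ->
  {in `]a, b[ &, {homo T : x y / x < y}} \/
    {in `]a, b[ &, {homo T : x y /~ x < y}} ->
  branch T `]a, b[.
Proof.
move=> a0 b1 cT mT; split.
- move=> x /=; rewrite in_itv/= => /andP[ax xb]; apply/I01E.
  by rewrite (le_trans a0 (ltW ax)) (le_trans (ltW xb) b1).
- exact: interval_is_interval.
- apply/connected_intervalP/connected_continuous_connected.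
    exact/connected_intervalP/interval_is_interval.
  by apply: continuous_in_subspaceT => x /set_mem xab; exact: cT.
- by case: mT => mT; [left|right] => x y /set_mem xab /set_mem yab; exact: mT.
Qed.

(** Induction over the cells of a monotonicity partition: [0,1] is a finite
    disjoint union of branches. *)
Lemma piecewise_monotone_ind T (Q : set R -> Prop) : piecewise_monotone T ->
  (forall C, branch T C -> Q C) ->
  (forall A B, A `&` B = set0 -> Q A -> Q B -> Q (A `|` B)) ->
  Q I01.
Proof.
move=> [s ps hs] Qb QU.
have Q1 a : I01 a -> Q [set a] by move=> aI; apply/Qb/branch_point.
suff gen t a : 0 <= a -> last a t <= 1 -> path <%R a t ->
    (forall i, (i < size t)%N ->
      let J := (`]nth 0 (a :: t) i, nth 0 t i[) in
      {in J, continuous T} /\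
      ({in J &, {homo T : x y / x < y}} \/ {in J &, {homo T : x y /~ x < y}})) ->
    Q `[a, last a t]%classic.
  by case: ps => p0 /eqP l1; rewrite /I01 -l1; apply: gen => //; rewrite l1.
elim: t a => [|c t ih] a a0 l1 /=.
  move=> _ _; rewrite set_itv1; apply: Q1; apply/I01E.
  by rewrite a0.
move=> /andP[ac pt] ht.
have cl : c <= last c t.
  by apply: (@itv_partition_le _ _ _ _ t); split.
have c1 : c <= 1 by exact: le_trans l1.
have -> : `[a, last c t]%classic = [set a] `|` (`]a, c[%classic `|` `[c, last c t]%classic).
  apply/seteqP; split => x /=; rewrite !in_itv/=.
    move=> /andP[ax xl]; have [xa|xa] := eqVneq x a; first by left.
    right; have [xc|cx] := ltP x c; last by right.
    by left; rewrite lt_neqAle eq_sym xa ax.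
  move=> [->|[/andP[ax xc]|/andP[cx xl]]].
  - by rewrite lexx (le_trans (ltW ac)).
  - by rewrite (ltW ax) (le_trans (ltW xc)).
  - by rewrite xl andbT (le_trans (ltW ac)).
apply: (QU _ _).
- apply/seteqP; split => // x /= [-> []]; rewrite in_itv/= ?ltxx//.
  by rewrite leNgt ac.
- by apply: Q1; apply/I01E; rewrite a0 (le_trans (ltW ac)).
apply: (QU _ _).
- apply/seteqP; split => // x /=; rewrite !in_itv/= => -[/andP[_ xc] /andP[cx _]].
  by move: xc; rewrite ltNge cx.
- by apply: Qb; have [cT mT] := ht 0%N isT; apply: branch_itv.
apply: ih => //; first exact: le_trans (ltW ac).
by move=> i it; exact: (ht i.+1 it).
Qed.

Lemma cutoffU (A B : set R) f : A `&` B = set0 ->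
  cutoff (A `|` B) f = cutoff A f \+ cutoff B f.
Proof.
move=> AB; apply/funext => x /=; rewrite /cutoff in_setU.
have [/set_mem Ax|nAx] := boolP (x \in A); last by rewrite /= add0r.
rewrite /= memNset ?addr0// => Bx.
by have : (A `&` B) x by []; rewrite AB.
Qed.

Lemma branch_monotone T C : branch T C -> monotone_on C T.
Proof.
move=> [_ _ _ [m|m]]; [left|right] => x y Cx Cy; rewrite le_eqVlt => /predU1P[->//|xy].
  by rewrite ltW//; apply: m => //; exact: mem_set.
by rewrite ltW//; apply: m => //; exact: mem_set.
Qed.

(** On one branch the composition with a monotone map is cut off outside an
    interval; the branches add up. *)
Lemma BV_comp f T : BV f -> piecewise_monotone T ->
  (forall x, I01 x -> I01 (T x)) -> BV (f \o T).
Proof.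
move=> bf pT TI.
suff : BV (cutoff I01 (f \o T)).
  by apply: eq_BV => x xI; rewrite /cutoff mem_set.
apply: (piecewise_monotone_ind (Q := fun A => BV (cutoff A (f \o T))) pT).
  move=> C bC; apply: BV_comp_monotone => //; first by case: bC.
    have [m|m] := branch_monotone bC; [left|right] => x y [_ Cx] [_ Cy]; exact: m.
  by move=> x xI _; exact: TI.
by move=> A B AB bA bB; rewrite cutoffU//; exact: BVD.
Qed.

Lemma branch_inj T C (x y : R) : branch T C -> C x -> C y -> T x = T y -> x = y.
Proof.
move=> [_ _ _ mT] /mem_set Cx /mem_set Cy Txy.
by have [xy|yx|//] := ltgtP x y; case: mT => m;
  [have := m _ _ Cx Cy xy|have := m _ _ Cy Cx xy
  |have := m _ _ Cy Cx yx|have := m _ _ Cx Cy yx]; rewrite Txy ltxx.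
Qed.

Lemma branch_fibre T C (x y : R) : branch T C -> C y -> T y = x ->
  C `&` T @^-1` [set x] = [set y].
Proof.
move=> bC Cy Tyx; apply/seteqP; split => [z [Cz /= Tz]|z -> //].
by apply: (branch_inj bC) => //; rewrite Tyx.
Qed.

(** A branch meets each fibre in at most one point, so its contribution to the
    sum is [f] composed with the inverse branch, which is monotone on the image
    interval of the branch and contributes 0 outside it. *)
Lemma fibre_sum_BV T f : BV f -> piecewise_monotone T ->
  (forall x, finite_set (I01 `&` T @^-1` [set x])) /\
  BV (fun x => \sum_(y \in I01 `&` T @^-1` [set x]) f y).
Proof.
move=> bf pT; apply: (piecewise_monotone_ind (Q := fun C =>
  (forall x, finite_set (C `&` T @^-1` [set x])) /\
  BV (fun x => \sum_(y \in C `&` T @^-1` [set x]) f y)) pT) => [C bC|].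
  pose s x := xget 0 (C `&` T @^-1` [set x]).
  have sP x : (T @` C) x -> C (s x) /\ T (s x) = x.
    move=> [y Cy Tyx]; rewrite /s.
    by case: xgetP => [z _ [Cz Tz]//|/(_ y)]; case.
  have fibre0 x : ~ (T @` C) x -> C `&` T @^-1` [set x] = set0.
    by move=> nx; apply/seteqP; split => // y [Cy Ty]; apply: nx; exists y.
  split=> [x|].
    have [/sP[Cs Ts]|/fibre0->] := pselect ((T @` C) x); last exact: finite_set0.
    by rewrite (branch_fibre bC Cs Ts); exact: finite_set1.
  have : BV (cutoff (T @` C) (f \o s)).
    have [CI _ iTC mT] := bC.
    apply: BV_comp_monotone => // [|x _ /sP[/CI]//].
    case: mT => m; [left|right] => x y [_ Jx] [_ Jy] xy; rewrite leNgt;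
      apply/negP => sxy; have [Cx Tx] := sP _ Jx; have [Cy Ty] := sP _ Jy.
      by have := m _ _ (mem_set Cy) (mem_set Cx) sxy; rewrite Tx Ty ltNge xy.
    by have := m _ _ (mem_set Cy) (mem_set Cx) sxy; rewrite Tx Ty ltNge xy.
  apply: eq_BV => x _; rewrite /cutoff.
  case: ifPn => [/set_mem /sP[Cs Ts]|/negP nx].
    by rewrite (branch_fibre bC Cs Ts) fsbig_set1.
  by rewrite fibre0 ?fsbig_set0// => /mem_set.
move=> A B AB [fA bA] [fB bB]; split=> [x|].
  by rewrite setIUl finite_setU; split.
apply: eq_BV (BVD bA bB) => x _ /=; rewrite setIUl fsbigU0// => y.
by move=> [[Ay _] [By _]]; rewrite -AB.
Qed.

End piecewise_monotone_maps.

(** * Integrals and the BV norm on a fibre *)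

Lemma ae_mono d (T : measurableType d) (R : realType)
    (mu : {measure set T -> \bar R}) (P Q : T -> Prop) :
  (forall x, P x -> Q x) -> (\forall x \ae mu, P x) -> \forall x \ae mu, Q x.
Proof. by move=> PQ; apply: filterS. Qed.

Section fibre_measure.
Context {R : realType} {d : measure_display} {W : measurableTopologicalType d}.
Variables (S : cocycle R W) (w : W).
Hypothesis conf1 : conf S w I01 = 1%E.
Implicit Types (f g h : R -> R) (J : set R).
Local Notation TV := (total_variation (0 : R) 1).

Lemma measurable_I01 : measurable (I01 : set (measurableTypeR R)).
Proof. exact: measurable_itv. Qed.

Lemma BV_integrable f : BV f -> (conf S w).-integrable I01 (EFin \o f).
Proof.
move=> bf; apply: measurable_bounded_integrable; first exact: measurable_I01.
- by rewrite conf1 ltry.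
- exact: BV_measurable.
have [M M0 fM] := BV_bounded bf; exists M; split; first exact: num_real.
by move=> x Mx y yI; apply: le_trans (fM _ yI) (ltW Mx).
Qed.

Lemma conf_intD f g : BV f -> BV g ->
  conf_int S w (fun x => f x + g x) = conf_int S w f + conf_int S w g.
Proof.
by move=> bf bg; apply: RintegralD; [exact: measurable_I01|exact: BV_integrable..].
Qed.

Lemma conf_intB f g : BV f -> BV g ->
  conf_int S w (fun x => f x - g x) = conf_int S w f - conf_int S w g.
Proof.
by move=> bf bg; apply: RintegralB; [exact: measurable_I01|exact: BV_integrable..].
Qed.

Lemma conf_intZ (c : R) f : BV f ->
  conf_int S w (fun x => c * f x) = c * conf_int S w f.
Proof.
by move=> bf; apply: RintegralZl; [exact: measurable_I01|exact: BV_integrable].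
Qed.

Lemma eq_conf_int f g : (forall x, I01 x -> f x = g x) ->
  conf_int S w f = conf_int S w g.
Proof. by move=> fg; apply: eq_Rintegral => x /set_mem; exact: fg. Qed.

Lemma ae_eq_conf_int f g : BV f -> BV g -> f = g %[ae conf S w in I01] ->
  conf_int S w f = conf_int S w g.
Proof.
move=> bf bg fg; rewrite /conf_int /Rintegral; congr fine.
apply: ae_eq_integral; first exact: measurable_I01.
- by apply/measurable_EFinP; exact: BV_measurable.
- by apply/measurable_EFinP; exact: BV_measurable.
- by apply: ae_mono fg => x fgx xI; rewrite fgx.
Qed.

Lemma BV_abs f : BV f -> BV (fun x => `|f x|).
Proof.
move=> [M hM]; exists M => _ [s ps <-].
apply: le_trans (hM _ (variations_variation f ps)).
apply: ler_sum => i _; exact: ler_dist_dist.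
Qed.

(** Almost everywhere [g - f] agrees with its absolute value. *)
Lemma ae_le_conf_int f g : BV f -> BV g ->
  (\forall x \ae conf S w, I01 x -> f x <= g x) ->
  conf_int S w f <= conf_int S w g.
Proof.
move=> bf bg fg; rewrite -subr_ge0 -conf_intB//.
rewrite (@ae_eq_conf_int _ (fun x => `|g x - f x|)); last first.
- by apply: ae_mono fg => x fgx xI; rewrite ger0_norm// subr_ge0 fgx.
- by apply: BV_abs; exact: BVB.
- exact: BVB.
by apply: Rintegral_ge0.
Qed.

Lemma le_conf_int f g : BV f -> BV g -> (forall x, I01 x -> f x <= g x) ->
  conf_int S w f <= conf_int S w g.
Proof. by move=> bf bg fg; apply: ae_le_conf_int => //; exact: aeW. Qed.

Lemma L1normE f : BV f -> L1norm S w f = (conf_int S w (fun x => `|f x|))%:E.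
Proof.
move=> bf; rewrite /L1norm /conf_int /Rintegral fineK//.
have := BV_integrable (BV_abs bf).
by move=> /integrable_fin_num; apply; exact: measurable_I01.
Qed.

Lemma conf_int_cst (c : R) : conf_int S w (cst c) = c.
Proof.
by rewrite /conf_int Rintegral_cst ?conf1 ?mulr1//; exact: measurable_I01.
Qed.

(** The BV norm dominates the supremum: compare [h x] with the average of [h]
    over the probability measure on the fibre. *)
Lemma sup_le_BVnorm h x : BV h -> I01 x ->
  (`|h x|%:E <= TV h + L1norm S w h)%E.
Proof.
move=> bh xI; have /BV_fin Th := bh; rewrite L1normE// -(fineK Th) -EFinD lee_fin.
rewrite -{1}(conf_int_cst `|h x|) -(conf_int_cst (fine (TV h))) -conf_intD//; last 2 first.
- exact: BV_cst.
- exact: BV_abs.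
apply: le_conf_int; first exact: BV_cst.
  by apply: BVD; [exact: BV_cst|exact: BV_abs].
move=> y yI /=; rewrite -lerBlDr -lee_fin fineK//.
apply: le_trans (TV_oscillation h xI yI); rewrite lee_fin.
by apply: le_trans (ler_dist_dist _ _); exact: ler_norm.
Qed.

Lemma L1norm_ge0 f : (0 <= L1norm S w f)%E.
Proof. by apply: integral_ge0 => x _; rewrite lee_fin. Qed.

(** The norm is an infimum over representatives; a strict bound selects one of
    them, which is then bounded at every point. *)
Lemma Bnorm_lt_representative f (c : R) : BV f -> (Bnorm S w f < c%:E)%E ->
  exists h, [/\ BV h, f = h %[ae conf S w in I01],
    (TV h + L1norm S w f < c%:E)%E & forall x, I01 x -> `|h x| <= c].
Proof.
move=> bf; have L1f := L1normE bf.
rewrite /Bnorm L1f -lteBrDr// => /ereal_inf_lt[_ [h hf <-]].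
rewrite lteBrDr// => Tc.
have fh : f = h %[ae conf S w in I01].
  by apply: ae_mono hf => x hfx xI; rewrite hfx.
have bh : BV h.
  apply/BV_fin; rewrite ge0_fin_numE ?total_variation_ge0//.
  by apply: le_lt_trans (lt_trans Tc (ltry _)); rewrite leeDl// -L1f L1norm_ge0.
exists h; split => // x xI; rewrite -lee_fin.
apply: le_trans (sup_le_BVnorm bh xI) _; rewrite L1normE//.
rewrite -(@ae_eq_conf_int (fun x => `|f x|)) ?ltW//; [exact: BV_abs..|].
by apply: ae_mono fh => y fhy yI; rewrite fhy.
Qed.

Lemma Bnorm_ae_bound f (c : R) : BV f -> (Bnorm S w f < c%:E)%E ->
  \forall x \ae conf S w, I01 x -> `|f x| <= c.
Proof.
move=> bf /(Bnorm_lt_representative bf)[h [_ fh _ hc]].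
by apply: ae_mono fh => x fhx xI; rewrite fhx// hc.
Qed.

(** The Leibniz rule for a representative [h] gives [2 M] from the variation of
    the indicator and [M] from that of [h]; the L1 norm gives another [M]. *)
Lemma Bnorm_indicM f J (M : R) : BV f -> is_interval J ->
  (Bnorm S w f < M%:E)%E -> (Bnorm S w (f \* \1_J)%R <= (4%:R * M)%:E)%E.
Proof.
move=> bf iJ /(Bnorm_lt_representative bf)[h [bh fh Tc hM]].
have bJ := BV_indic iJ; have I0 : I01 (0 : R) by apply/I01E; rewrite lexx ler01.
have M0 : 0 <= M by exact: le_trans (hM _ I0).
have J1 x : `|\1_J x : R| <= 1 by rewrite indicE; case: (x \in J); rewrite ?normr1 ?normr0.
have TM : (TV h <= M%:E)%E by apply: le_trans (ltW Tc); rewrite leeDl// L1norm_ge0.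
have LM : (L1norm S w f <= M%:E)%E.
  by apply: le_trans (ltW Tc); rewrite leeDr// total_variation_ge0.
have : (TV (h \* \1_J)%R <= (3%:R * M)%:E)%E.
  apply: (le_trans (TVM bh bJ hM (fun x _ => J1 x))).
  rewrite mul1e (_ : 3 * M = M * 2 + M); last by ring.
  by rewrite EFinD leeD// EFinM lee_wpmul2l ?lee_fin// TV_indic.
move=> T3; rewrite /Bnorm (_ : 4 * M = 3 * M + M); last by ring.
rewrite EFinD leeD//.
  apply: (le_trans _ T3); apply: ereal_inf_lbound; exists (h \* \1_J) => //=.
  by apply: ae_mono fh => x fhx xI; rewrite fhx.
apply: (le_trans _ LM); rewrite !L1normE//; last exact: BVM.
rewrite lee_fin; apply: le_conf_int; [exact/BV_abs/BVM|exact: BV_abs|].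
by move=> x xI; rewrite normrM ler_piMr.
Qed.

End fibre_measure.

(** * Transfer duality and decorrelation of targets *)

Section transfer_duality.
Context {R : realType} {d : measure_display} {W : measurableTopologicalType d}.
Variables (m : probability W R) (S : cocycle R W).
Hypothesis hS : closed_system m S.
Implicit Types (w : W) (f h u v : R -> R) (n : nat).

Lemma fibre_map_I01 w x : I01 x -> I01 (fibre_map S w x).
Proof. by move=> xI; rewrite -[I01](cs_surjective hS w); exists x. Qed.

Lemma BV_fibre_iter n w f : BV f -> BV (f \o fibre_iter S n w).
Proof.
elim: n f => // n ih f bf.
apply: (ih (f \o fibre_map S (iter n (base S) w))).
apply: BV_comp bf (cs_monotone hS _) _ => x; exact: fibre_map_I01.
Qed.

Lemma transfer_BV w f : BV f -> BV (transfer S w f).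
Proof.
move=> bf; have [_] := fibre_sum_BV (BVM (cs_weight_BV hS w) bf) (cs_monotone hS w).
by apply: eq_BV => x _.
Qed.

Lemma normalized_transfer_BV w f : BV f -> BV (normalized_transfer S w f).
Proof. by move=> bf; apply: BVZ; exact: transfer_BV. Qed.

Lemma normalized_transfer_iter_BV n w f :
  BV f -> BV (normalized_transfer_iter S n w f).
Proof. by move=> bf; elim: n => //= n ih; exact: normalized_transfer_BV. Qed.

(** On the fibre of [x] the factor [u o T] is the constant [u x]. *)
Lemma transfer_pull w u f x :
  transfer S w (fun y => u (fibre_map S w y) * f y) x = u x * transfer S w f x.
Proof.
rewrite /transfer fsbig_distrr/=; last first.
  exact: (proj1 (fibre_sum_BV (cs_weight_BV hS w) (cs_monotone hS w)) x).
by apply: eq_fsbigr => y /set_mem[_ /= ->]; rewrite mulrCA.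
Qed.

Variables (c M D kappa : R).
Hypothesis c0 : 0 < c.
Hypothesis D0 : 0 < D.
Hypothesis kappa01 : 0 < kappa < 1.

(** Everything about a single fibre that the decorrelation estimate needs, with
    constants that do not depend on the fibre. *)
Record regular_fibre w : Prop := RegularFibre {
  rf_dens_BV : BV (dens S w) ;
  rf_dens_ge : forall x, I01 x -> c <= dens S w x ;
  rf_dens_norm : (Bnorm S w (dens S w) < M%:E)%E ;
  rf_dens_int : conf_int S w (dens S w) = 1 ;
  rf_conformal : forall f, BV f ->
    conf_int S (base S w) (transfer S w f) = eigv S w * conf_int S w f ;
  rf_eigenfunction :
    transfer S w (dens S w) = (fun x => eigv S w * dens S (base S w) x)
      %[ae conf S (base S w) in I01] ;
  rf_spectral_gap : forall n f, BV f ->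
    (Bnorm S (sigma_iter S n w)
       (fun x => normalized_transfer_iter S n w f x
                 - conf_int S w f * dens S (sigma_iter S n w) x)%R
     <= D%:E * Bnorm S w f * (kappa ^+ n)%R%:E)%E
}.

Definition regular_orbit w : Prop := forall n, regular_fibre (sigma_iter S n w).

Lemma sigma_iterD i j w :
  sigma_iter S (i + j) w = sigma_iter S i (sigma_iter S j w).
Proof. exact: iterD. Qed.

Lemma fibre_iterD i j w x :
  fibre_iter S (i + j) w x = fibre_iter S i (sigma_iter S j w) (fibre_iter S j w x).
Proof.
elim: i => [//|i ih]; rewrite addSn /fibre_iter /=.
by rewrite -/(fibre_iter S (i + j) w x) ih iterD.
Qed.

Lemma regular_orbit_iter n w : regular_orbit w -> regular_orbit (sigma_iter S n w).
Proof. by move=> rw k; rewrite -sigma_iterD. Qed.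

Let conf1 w : conf S w I01 = 1%E := cs_conf_supported hS w.

Lemma transfer_dual w u f : regular_fibre w -> BV u -> BV f ->
  conf_int S (base S w) (fun x => u x * normalized_transfer S w f x) =
  conf_int S w (fun x => u (fibre_map S w x) * f x).
Proof.
move=> rw bu bf.
have buT : BV (fun x => u (fibre_map S w x)).
  by apply: BV_comp bu (cs_monotone hS w) _ => x; exact: fibre_map_I01.
have e0 : eigv S w != 0 by rewrite gt_eqF// (cs_eigv_gt0 hS).
rewrite -[RHS](mulKf e0) -rf_conformal//; last exact: BVM.
rewrite -conf_intZ//; last exact/transfer_BV/BVM.
by apply: eq_conf_int => x xI; rewrite transfer_pull mulrCA.
Qed.

(** Conformality turns composition with the dynamics into the transfer operator;
    it applies at each step because bounded variation is preserved. *)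
Lemma transfer_iter_dual n w u f : regular_orbit w -> BV u -> BV f ->
  conf_int S (sigma_iter S n w) (fun x => u x * normalized_transfer_iter S n w f x) =
  conf_int S w (fun x => u (fibre_iter S n w x) * f x).
Proof.
move=> rw; elim: n u => [//|n ih] u bu bf.
rewrite [LHS](transfer_dual (rw n) bu); last exact: normalized_transfer_iter_BV.
rewrite ih//; apply: BV_comp bu (cs_monotone hS _) _ => x; exact: fibre_map_I01.
Qed.

Definition equi_mean w f : R := conf_int S w (fun x => dens S w x * f x).

(** Invariance of the family mu, from duality and the eigenfunction equation. *)
Lemma equi_mean_fibre_map w f : regular_fibre w -> regular_fibre (base S w) -> BV f ->
  equi_mean w (fun x => f (fibre_map S w x)) = equi_mean (base S w) f.
Proof.
move=> rw rbw bf; rewrite /equi_mean.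
under eq_conf_int do rewrite mulrC.
have bd := rf_dens_BV rw.
rewrite -transfer_dual//.
apply: ae_eq_conf_int => //.
- by apply: BVM => //; exact: normalized_transfer_BV.
- by apply: BVM => //; exact: rf_dens_BV.
apply: ae_mono (rf_eigenfunction rw) => x h xI.
rewrite /normalized_transfer h// mulKf 1?mulrC//.
by rewrite gt_eqF// (cs_eigv_gt0 hS).
Qed.

Lemma equi_mean_fibre_iter n w f : regular_orbit w -> BV f ->
  equi_mean w (fun x => f (fibre_iter S n w x)) = equi_mean (sigma_iter S n w) f.
Proof.
move=> rw; elim: n f => [//|n ih] f bf.
rewrite -[RHS](equi_mean_fibre_map (rw n) (rw n.+1) bf).
rewrite -ih//; apply: BV_comp bf (cs_monotone hS _) _ => x; exact: fibre_map_I01.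
Qed.

Lemma regular_M_gt0 w : regular_fibre w -> 0 < M.
Proof.
move=> rw; rewrite -lte_fin; apply: le_lt_trans (rf_dens_norm rw).
rewrite adde_ge0 ?L1norm_ge0//; apply: le_ereal_inf_tmp => _ [h _ <-].
exact: total_variation_ge0.
Qed.

(** By duality the left-hand side integrates the transfer of phi times the
    indicator of [A] over [B]. The spectral gap replaces the transfer by a
    multiple of phi up to a uniform error, and phi being at least [c] turns the
    nu-measure of [B] in the error term into its mu-measure over [c]. *)
Lemma target_decorrelation n w (A B : set R) : regular_orbit w ->
  is_interval A -> is_interval B ->
  equi_mean w (fun x => \1_A x * \1_B (fibre_iter S n w x)) <=
  equi_mean w \1_A * equi_mean (sigma_iter S n w) \1_B +
  8 * D * M / c * kappa ^+ n * equi_mean (sigma_iter S n w) \1_B.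
Proof.
move=> rw iA iB; have bA := BV_indic iA; have bB := BV_indic iB.
have r0 := rw 0%N; have rn := rw n; rewrite /sigma_iter/= -/(sigma_iter _ _ _) in r0.
have M0 := regular_M_gt0 r0; have [k0 k1] := andP kappa01.
have bd := rf_dens_BV r0; have bdn := rf_dens_BV rn.
pose h : R -> R := dens S w \* \1_A; have bh : BV h by exact: BVM.
pose v := sigma_iter S n w.
pose b : R := 8 * D * M * kappa ^+ n.
have kn0 : 0 < kappa ^+ n by rewrite exprn_gt0.
have b0 : 0 < b by rewrite !mulr_gt0.
have bL : BV (normalized_transfer_iter S n w h) by exact: normalized_transfer_iter_BV.
have ah : conf_int S w h = equi_mean w \1_A by [].
have bF : BV (fun x => normalized_transfer_iter S n w h x - conf_int S w h * dens S v x).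
  by apply: BVB => //; exact: BVZ.
have bound : \forall x \ae conf S v, I01 x ->
    `|normalized_transfer_iter S n w h x - conf_int S w h * dens S v x| <= b.
  apply: Bnorm_ae_bound => //.
  apply: (le_lt_trans (rf_spectral_gap r0 n bh)).
  have h4 := Bnorm_indicM (conf1 w) bd iA (rf_dens_norm r0).
  apply: (@le_lt_trans _ _ (D%:E * (4 * M)%:E * (kappa ^+ n)%:E)%E).
    by rewrite lee_pmul2r// lee_pmul2l.
  (* Bnorm_indicM gives 4 M; the other factor 2 in b makes the bound strict. *)
  rewrite -!EFinM lte_fin /b (_ : 8 * D * M * kappa ^+ n =
     D * (4 * M) * kappa ^+ n + 4 * D * M * kappa ^+ n); last by ring.
  by rewrite ltrDl !mulr_gt0.
have -> : equi_mean w (fun x => \1_A x * \1_B (fibre_iter S n w x)) =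
    conf_int S v (fun x => \1_B x * normalized_transfer_iter S n w h x).
  rewrite transfer_iter_dual//; apply: eq_conf_int => x _.
  by rewrite /h /=; ring.
rewrite (_ : 8 * D * M / c * kappa ^+ n = b / c); last by rewrite /b; ring.
rewrite -mulrDl -conf_intZ//; last exact: BVM.
apply: ae_le_conf_int => //; [exact: BVM|exact/BVZ/BVM|].
apply: ae_mono bound => x bx xI; have := bx xI.
rewrite ler_norml => /andP[_]; rewrite lerBlDr ah => le1.
rewrite indicE; case: (x \in B); rewrite ?mul0r ?mulr0// mul1r mulr1.
rewrite mulrDl [leRHS]addrC (le_trans le1)// lerD2r.
rewrite -mulrA ler_peMr ?(ltW b0)//.
by rewrite mulrC ler_pdivlMr// mul1r (rf_dens_ge rn).
Qed.

End transfer_duality.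

(** * Variance of the number of visits *)

Section variance_of_hits.
Context {R : realType} {d : measure_display} {W : measurableTopologicalType d}.
Variables (m : probability W R) (S : cocycle R W).
Hypothesis hS : closed_system m S.
Variables (c M D kappa : R).
Hypothesis c0 : 0 < c.
Hypothesis D0 : 0 < D.
Hypothesis kappa01 : 0 < kappa < 1.
Variable w : W.
Hypothesis rw : regular_orbit S c M D kappa w.
Variable B : nat -> set R.
Hypothesis iB : forall k, is_interval (B k).

Local Notation E := (equi_mean S w).
Let conf1 : conf S w I01 = 1%E := cs_conf_supported hS w.
Let bd : BV (dens S w) := rf_dens_BV (rw 0%N).

Lemma equi_meanD f g : BV f -> BV g -> E (fun x => f x + g x) = E f + E g.
Proof.
move=> bf bg; rewrite /equi_mean -conf_intD//; [|exact: BVM..].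
by apply: eq_conf_int => x _; rewrite mulrDr.
Qed.

Lemma equi_meanZ (a : R) f : BV f -> E (fun x => a * f x) = a * E f.
Proof.
move=> bf; rewrite /equi_mean -conf_intZ//; last exact: BVM.
by apply: eq_conf_int => x _; rewrite mulrCA.
Qed.

Lemma eq_equi_mean f g : (forall x, I01 x -> f x = g x) -> E f = E g.
Proof. by move=> fg; apply: eq_conf_int => x xI; rewrite fg. Qed.

Lemma equi_mean_cst (a : R) : E (cst a) = a.
Proof.
rewrite /equi_mean -[RHS]mulr1 -(rf_dens_int (rw 0%N)) -conf_intZ//.
by apply: eq_conf_int => x _; rewrite mulrC.
Qed.

Lemma equi_mean_sum n (F : nat -> R -> R) : (forall k, BV (F k)) ->
  E (fun x => \sum_(k < n) F k x) = \sum_(k < n) E (F k).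
Proof.
move=> bF; elim: n => [|n ih].
  rewrite big_ord0 -[RHS](equi_mean_cst 0).
  by apply: eq_equi_mean => x _; rewrite big_ord0.
rewrite big_ord_recr /= -ih -equi_meanD//; last by apply: BV_sum.
by apply: eq_equi_mean => x _; rewrite big_ord_recr.
Qed.

Definition visit k x : R := \1_(B k) (fibre_iter S k w x).
Definition visit_mean k : R := equi_mean S (sigma_iter S k w) \1_(B k).

Lemma visit_BV k : BV (visit k).
Proof. exact: (BV_fibre_iter hS k w (BV_indic (@iB k))). Qed.

Lemma visit_meanE k : E (visit k) = visit_mean k.
Proof. exact: (equi_mean_fibre_iter hS k rw (BV_indic (@iB k))). Qed.

Lemma visit_idem k x : visit k x * visit k x = visit k x.
Proof. by rewrite /visit indicE; case: (_ \in _); rewrite ?mulr1 ?mulr0. Qed.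

Lemma visit_mean_ge0 k : 0 <= visit_mean k.
Proof.
apply: Rintegral_ge0 => x xI; apply: mulr_ge0; last by rewrite indicE.
by apply: le_trans (ltW c0) _; exact: (rf_dens_ge (rw k)).
Qed.

Lemma visit_mean_le1 k : visit_mean k <= 1.
Proof.
rewrite -visit_meanE -(equi_mean_cst 1).
apply: le_conf_int => //; [exact/BVM/visit_BV|exact/BVM/BV_cst|].
move=> x xI; apply: ler_wpM2l; last by rewrite /visit indicE; case: (_ \in _).
by apply: le_trans (ltW c0) _; exact: (rf_dens_ge (rw 0%N)).
Qed.

Definition decorrelation_cst : R := 8 * D * M / c.

Lemma visit_correlation i j : (i <= j)%N ->
  E (fun x => visit i x * visit j x) <= visit_mean i * visit_mean j
    + decorrelation_cst * kappa ^+ (j - i) * visit_mean j.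
Proof.
move=> ij; have rwi := regular_orbit_iter i rw.
pose F x : R := \1_(B i) x * \1_(B j) (fibre_iter S (j - i) (sigma_iter S i w) x).
have -> : E (fun x => visit i x * visit j x) = E (fun x => F (fibre_iter S i w x)).
  by apply: eq_equi_mean => x _; rewrite /F /visit -fibre_iterD subnK.
rewrite (equi_mean_fibre_iter hS i rw); last first.
  by apply: BVM; [exact: BV_indic|exact: (BV_fibre_iter hS _ _ (BV_indic (@iB j)))].
have := target_decorrelation hS c0 D0 kappa01 (j - i) rwi (@iB i) (@iB j).
by rewrite -sigma_iterD subnK.
Qed.

Definition deviation n x : R := \sum_(k < n) (visit k x - visit_mean k).

Lemma deviation_BV n : BV (deviation n).
Proof.
apply: (BV_sum (F := fun k x => visit k x - visit_mean k)) => k _.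
by apply: BVB (visit_BV k) (BV_cst _).
Qed.

Lemma geometric_le n : \sum_(k < n) kappa ^+ (n - k) <= kappa / (1 - kappa).
Proof.
have [k0 k1] := andP kappa01; have k1' : 0 < 1 - kappa by rewrite subr_gt0.
elim: n => [|n ih]; first by rewrite big_ord0 divr_ge0// ltW.
rewrite big_ord_recr /= subSnn expr1.
rewrite (eq_bigr (fun k : 'I_n => kappa * kappa ^+ (n - k))); last first.
  by move=> k _; rewrite -exprS subSn// ltnW.
rewrite -mulr_sumr (_ : kappa / (1 - kappa) = kappa * (kappa / (1 - kappa)) + kappa).
  by rewrite lerD2r ler_wpM2l// ltW.
by field; rewrite gt_eqF.
Qed.

Definition hit_variance_cst : R :=
  1 + 2 * (decorrelation_cst * (kappa / (1 - kappa))).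

(** Adding visit [n] changes the variance by twice its covariances with the
    earlier visits, a geometric series times its mean, and by its own variance,
    at most its mean since a visit is an indicator. *)
Lemma variance_le n :
  E (fun x => deviation n x ^+ 2) <= hit_variance_cst * \sum_(k < n) visit_mean k.
Proof.
have M0 := regular_M_gt0 (rw 0%N); have C0 : 0 <= decorrelation_cst.
  by rewrite /decorrelation_cst divr_ge0// ltW// !mulr_gt0.
elim: n => [|n ih].
  rewrite big_ord0 mulr0 -[leRHS](equi_mean_cst 0) le_eqVlt; apply/orP; left.
  by apply/eqP/eq_equi_mean => x _; rewrite /deviation big_ord0 expr0n.
set p := visit_mean n.
pose Y k x := visit k x - visit_mean k.
have bY k : BV (Y k) by apply: BVB (visit_BV k) (BV_cst _).
have split_sq : E (fun x => deviation n.+1 x ^+ 2) = E (fun x => deviation n x ^+ 2)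
    + (2 * \sum_(k < n) E (fun x => Y k x * Y n x) + E (fun x => Y n x * Y n x)).
  have bdev := deviation_BV n.
  rewrite -(equi_mean_sum n (fun k => BVM (bY k) (bY n))) -equi_meanZ; last first.
    by apply: (BV_sum (F := fun k x => Y k x * Y n x)) => k _; exact: BVM.
  rewrite -equi_meanD; last 2 first.
  - by apply/BVZ/(BV_sum (F := fun k x => Y k x * Y n x)) => k _; exact: BVM.
  - exact: BVM.
  rewrite -equi_meanD; last 2 first.
  - exact: (BVM bdev bdev).
  - apply: BVD (BVM (bY n) (bY n)).
    by apply/BVZ/(BV_sum (F := fun k x => Y k x * Y n x)) => k _; exact: BVM.
  apply: eq_equi_mean => x _; rewrite /deviation big_ord_recr/= -mulr_suml.
  by rewrite -/(Y n x); set s := \sum_(k < n) _; ring.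
have covE k : E (fun x => Y k x * Y n x) =
    E (fun x => visit k x * visit n x) - visit_mean k * p.
  have bk := visit_BV k; have bn := visit_BV n.
  transitivity (E (fun x => visit k x * visit n x + (- p * visit k x +
     (- visit_mean k * visit n x + visit_mean k * p)))).
    by apply: eq_equi_mean => x _; rewrite /Y -/p; ring.
  have b1 : BV (fun x => - visit_mean k * visit n x + visit_mean k * p).
    by apply: BVD (BVZ _ bn) (BV_cst _).
  rewrite equi_meanD; [|exact: BVM|exact: BVD (BVZ _ bk) b1].
  rewrite equi_meanD; [|exact: BVZ|exact: b1].
  rewrite equi_meanD; [|exact: BVZ|exact: BV_cst].
  rewrite (equi_meanZ _ bk) (equi_meanZ _ bn) !visit_meanE -/p.
  rewrite [E (fun=> visit_mean k * p)]equi_mean_cst; ring.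
rewrite split_sq big_ord_recr/= mulrDr lerD//.
have cov_le : \sum_(k < n) E (fun x => Y k x * Y n x) <=
    decorrelation_cst * (kappa / (1 - kappa)) * p.
  apply: (@le_trans _ _ (\sum_(k < n) decorrelation_cst * kappa ^+ (n - k) * p)).
    apply: ler_sum => k _; rewrite covE lerBlDl.
    by apply: visit_correlation; exact: ltnW.
  rewrite -mulr_suml -mulr_sumr ler_wpM2r ?visit_mean_ge0//.
  by rewrite ler_wpM2l// geometric_le.
have var1 : E (fun x => Y n x * Y n x) <= p.
  rewrite covE (eq_equi_mean (fun x _ => visit_idem n x)) visit_meanE -/p.
  by rewrite lerBlDr lerDl mulr_ge0// visit_mean_ge0.
rewrite -/p (_ : hit_variance_cst * p =
  2 * (decorrelation_cst * (kappa / (1 - kappa)) * p) + p).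
  by rewrite lerD// ler_pM2l.
by rewrite /hit_variance_cst; ring.
Qed.

End variance_of_hits.

(** * From sparse times to all times *)

Section counting_along_thresholds.
Context {R : realType}.
Implicit Types (E H : nat -> R) (t : nat -> nat).

(** The increments being at most 1, the threshold is overshot by at most 1. *)
Lemma first_passage_times E : E 0%N = 0 -> (forall n, E n.+1 <= E n + 1) ->
  E n @[n --> \oo] --> +oo ->
  exists t : nat -> nat, forall k, [/\ k.+1%:R ^+ 2 <= E (t k),
    E (t k) <= k.+1%:R ^+ 2 + 1 & forall i, (i < t k)%N -> E i < k.+1%:R ^+ 2].
Proof.
move=> E0 E1 /cvgryPge Eoo.
suff step k : exists n, [/\ k.+1%:R ^+ 2 <= E n,
    E n <= k.+1%:R ^+ 2 + 1 & forall i, (i < n)%N -> E i < k.+1%:R ^+ 2].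
  by have [t tP] := choice step; exists t.
have ex : exists n, k.+1%:R ^+ 2 <= E n.
  by have [N _ hN] := Eoo (k.+1%:R ^+ 2); exists N; apply: hN => /=.
case: (ex_minnP ex) => n kn nmin; exists n.
have below i : (i < n)%N -> E i < k.+1%:R ^+ 2.
  by move=> ni; rewrite ltNge; apply/negP => /nmin; rewrite leqNgt ni.
split => //; case: n kn nmin below => [|n] kn nmin below.
  by rewrite E0 addr_ge0// exprn_ge0.
by apply: le_trans (E1 n) _; rewrite lerD2r ltW// below.
Qed.

(** If E n lies between (k+1)^2 and (k+2)^2 then [n] lies between [t k] and
    [t k.+1], so that [H n] is squeezed between the values of [H] there; the two
    thresholds differ by a negligible fraction. *)
Lemma ratio_cvg1 E H t : (forall i j, (i <= j)%N -> E i <= E j) ->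
  (forall i j, (i <= j)%N -> H i <= H j) -> E n @[n --> \oo] --> +oo ->
  (forall k, [/\ k.+1%:R ^+ 2 <= E (t k),
    E (t k) <= k.+1%:R ^+ 2 + 1 & forall i, (i < t k)%N -> E i < k.+1%:R ^+ 2]) ->
  (forall e, 0 < e -> \forall k \near \oo,
     `|H (t k) - E (t k)| <= e * k.+1%:R ^+ 2) ->
  (E n)^-1 * H n @[n --> \oo] --> (1 : R).
Proof.
move=> mE mH Eoo tP small; apply/cvgrPdist_le => e e0.
(* With a = k+1, the total error is at most 4 a + 4 e' a^2, and a <= e' a^2. *)
pose e' := e / 8; have e'0 : 0 < e' by rewrite divr_gt0.
have [K0 _ hK0] := small _ e'0.
have [K1 _ hK1] : \forall k \near \oo, e'^-1 <= k%:R.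
  by near=> k; apply: le_trans (ltW (truncnS_gt _)) _; rewrite ler_nat; near: k;
     exact: nbhs_infty_gt.
pose K := maxn K0 K1.
exists (t K) => // n /= tKn; have [KE _ _] := tP K.
have KEn : K.+1%:R ^+ 2 <= E n by apply: le_trans KE _; exact: mE.
have ex : exists k, E n < k.+2%:R ^+ 2.
  exists (Num.truncn (E n)); apply: lt_le_trans (truncnS_gt _) _.
  by rewrite -natrX ler_nat (leq_trans (leqnSn _))// expnS leq_pmulr// expn_gt0.
case: (ex_minnP ex) => k kE kmin.
have Kk : (K <= k)%N.
  have : (K.+1%:R ^+ 2 : R) < k.+2%:R ^+ 2 by apply: le_lt_trans kE.
  by rewrite -!natrX ltr_nat ltn_exp2r.
have kE' : k.+1%:R ^+ 2 <= E n.
  case: k kE kmin Kk => [|k] kE kmin Kk.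
    by move: KEn; move: Kk; rewrite leqn0 => /eqP ->.
  by rewrite leNgt; apply/negP => /kmin; rewrite ltnn.
have tkn : (t k <= n)%N.
  rewrite leqNgt; apply/negP => ntk; have [_ _ /(_ _ ntk)] := tP k.
  by rewrite ltNge kE'.
have ntk1 : (n <= t k.+1)%N.
  rewrite leqNgt; apply/negP => /ltnW/mE; have [h _ _] := tP k.+1.
  by rewrite leNgt (lt_le_trans kE).
have [lo _ _] := tP k; have [_ hi _] := tP k.+1.
have := hK0 k; have := hK0 k.+1; rewrite /= (leq_trans _ Kk) ?leq_maxl//.
rewrite (leq_trans _ (leqW Kk)) ?leq_maxl// => /(_ isT) h1 /(_ isT) h0.
have ae : e'^-1 <= k.+1%:R.
  by apply: hK1 => /=; rewrite (leq_trans _ (leqW Kk))// leq_maxr.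
have := mH _ _ tkn; have := mH _ _ ntk1.
move: h1 h0 lo hi kE kE'; rewrite -(natr1 k.+1).
have a1 : 1 <= k.+1%:R :> R by rewrite ler1n.
set a : R := k.+1%:R in ae a1 *.
rewrite !ler_norml => /andP[_ h1] /andP[h0 _] lo hi kE kE' Hhi Hlo.
have ea : 1 <= e' * a by rewrite -(ler_pdivrMl _ _ e'0) mulr1.
have a0 : 0 < a by exact: lt_le_trans a1.
have En0 : 0 < E n by apply: lt_le_trans kE'; rewrite exprn_gt0.
have ea2 : a <= e' * a ^+ 2 by rewrite expr2 mulrA ler_peMl// ltW.
have aa : a <= a ^+ 2 by rewrite expr2 ler_peMl// ltW.
have eaa : e' * a <= e' * a ^+ 2 by rewrite ler_pM2l.
have eE : e' * a ^+ 2 <= e' * E n by rewrite ler_pM2l.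
have e8 : e = 8 * e' by rewrite /e' mulrC divfK.
have -> : 1 - (E n)^-1 * H n = (E n)^-1 * (E n - H n).
  by rewrite mulrBr mulVf// gt_eqF.
rewrite ler_pdivrMl// ler_pdivlMl// e8.
rewrite !sqrrD !expr1n !mulr1 in h1 hi kE *.
have e'a : e' <= e' * a by rewrite ler_peMr// ltW.
apply/andP; split; lra.
Unshelve. all: by end_near.
Qed.

End counting_along_thresholds.

(** * Strong law for the number of visits *)

(** The sum of the series is integrable, hence finite almost everywhere. *)
Lemma ae_cvg0_of_summable_integrals d (T : measurableType d) (R : realType)
    (mu : {measure set T -> \bar R}) (D : set T) (Z : nat -> T -> R) (b : R) :
  measurable D -> (forall k, measurable_fun D (Z k)) ->
  (forall k x, D x -> 0 <= Z k x) ->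
  (forall n, \sum_(0 <= k < n) \int[mu]_(x in D) (Z k x)%:E <= b%:E)%E ->
  \forall x \ae mu, D x -> Z k x @[k --> \oo] --> 0.
Proof.
move=> mD mZ Z0 Zb.
have mEZ k : measurable_fun D (fun x => (Z k x)%:E) by apply/measurable_EFinP.
have EZ0 k x : D x -> (0 <= (Z k x)%:E)%E by move=> Dx; rewrite lee_fin Z0.
pose F x := (\sum_(k <oo) (Z k x)%:E)%E.
have mF : measurable_fun D F.
  by apply: ge0_emeasurable_sum => [k x Dx _|k _]; [exact: EZ0|exact: mEZ].
have F0 x : D x -> (0 <= F x)%E.
  by move=> Dx; apply: nneseries_ge0 => k _ _; exact: EZ0.
have iF : mu.-integrable D F.
  apply/integrableP; split => //.
  rewrite (eq_integral F); last first.
    by move=> x /set_mem Dx; rewrite gee0_abs// F0.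
  rewrite integral_nneseries//; apply: le_lt_trans (ltry b).
  apply: lime_le.
    by apply: is_cvg_nneseries => k _ _; apply: integral_ge0 => x; exact: EZ0.
  by apply: nearW => n; exact: Zb.
have := integrable_ae mD iF; apply: ae_mono => x Ffin Dx.
have {}Ffin := Ffin Dx.
apply: cvg_series_cvg_0; apply: nondecreasing_is_cvgn.
  by apply: nondecreasing_series => k _ _; exact: Z0.
exists (fine (F x)) => _ [n _ <-].
rewrite -lee_fin fineK// /series /= -sumEFin.
by apply: nneseries_lim_ge => k _ _; exact: EZ0.
Qed.

Section strong_law.
Context {R : realType} {d : measure_display} {W : measurableTopologicalType d}.
Variables (m : probability W R) (S : cocycle R W).
Hypothesis hS : closed_system m S.
Variables (c M D kappa : R).
Hypothesis c0 : 0 < c.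
Hypothesis D0 : 0 < D.
Hypothesis kappa01 : 0 < kappa < 1.
Variable w : W.
Hypothesis rw : regular_orbit S c M D kappa w.
Variable B : nat -> set R.
Hypothesis iB : forall k, is_interval (B k).

Local Notation E n := (\sum_(k < n) visit_mean S w B k).
Local Notation H n x := (\sum_(k < n) visit S w B k x).
Hypothesis Eoo : E n @[n --> \oo] --> +oo.

Lemma deviationE n x : deviation S w B n x = H n x - E n.
Proof. by rewrite /deviation sumrB. Qed.

(** From 1/(n+1)^2 <= 1/n - 1/(n+1) the first [n] terms stay below 2 - 1/n. *)
Lemma sum_inv_squares_le n : \sum_(k < n) (k.+1%:R ^+ 2)^-1 <= 2 :> R.
Proof.
case: n => [|n]; first by rewrite big_ord0.
suff : \sum_(k < n.+1) (k.+1%:R ^+ 2)^-1 <= 2 - n.+1%:R^-1 :> R.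
  by move=> /le_trans; apply; rewrite gerBl.
elim: n => [|n ih]; first by rewrite big_ord_recr big_ord0/= expr1n invr1; lra.
rewrite big_ord_recr/=; apply: le_trans (lerD ih (lexx _)) _.
rewrite -subr_ge0 -(natr1 n.+1); set a : R := n.+1%:R.
have a0 : 0 < a by rewrite ltr0n.
rewrite (_ : _ - _ = (a * (a + 1) ^+ 2)^-1).
  by rewrite invr_ge0 mulr_ge0 ?exprn_ge0// ltW// addr_gt0.
by field; rewrite !gt_eqF// addr_gt0.
Qed.

(** Chebyshev and Borel-Cantelli along the first passage times of (k+1)^2, in
    the form of a convergent series of normalized squared deviations. *)
Lemma visit_counting_law :
  \forall x \ae conf S w, I01 x -> (E n)^-1 * H n x @[n --> \oo] --> (1 : R).
Proof.
have conf1 : conf S w I01 = 1%E := cs_conf_supported hS w.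
have bd : BV (dens S w) := rf_dens_BV (rw 0%N).
have p0 k : 0 <= visit_mean S w B k := visit_mean_ge0 c0 rw B k.
have [t tP] : exists t : nat -> nat, forall k, [/\ k.+1%:R ^+ 2 <= E (t k),
    E (t k) <= k.+1%:R ^+ 2 + 1 & forall i, (i < t k)%N -> E i < k.+1%:R ^+ 2].
  apply: (first_passage_times (E := fun n => E n)) => //.
    by rewrite big_ord0.
  by move=> n; rewrite big_ord_recr/= lerD2l (visit_mean_le1 hS c0 rw).
pose Z k x := dens S w x * (deviation S w B (t k) x ^+ 2 / (k.+1%:R ^+ 2) ^+ 2).
have bdev k : BV (fun x => deviation S w B (t k) x ^+ 2).
  have bD := deviation_BV hS w iB (t k).
  exact: (BVM bD bD).
have bZ k : BV (Z k).
  apply: BVM bd _; apply: eq_BV (BVZ ((k.+1%:R ^+ 2) ^+ 2)^-1 (bdev k)) => x _.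
  by rewrite mulrC.
pose V := hit_variance_cst c M D kappa.
have V0 : 0 <= V.
  have M0 := regular_M_gt0 (rw 0%N); have [k0 k1] := andP kappa01.
  rewrite /V /hit_variance_cst addr_ge0// mulr_ge0// mulr_ge0//.
    by rewrite /decorrelation_cst divr_ge0// ltW// !mulr_gt0.
  by rewrite divr_ge0// ltW// subr_gt0.
have IZ k : (\int[conf S w]_(x in I01) (Z k x)%:E <=
    (2 * V * (k.+1%:R ^+ 2)^-1)%:E)%E.
  have -> : (\int[conf S w]_(x in I01) (Z k x)%:E = (conf_int S w (Z k))%:E)%E.
    rewrite /conf_int /Rintegral fineK//.
    by apply: integrable_fin_num; [exact: measurable_I01|exact: BV_integrable].
  have sq0 : 0 < k.+1%:R ^+ 2 :> R by rewrite exprn_gt0.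
  have sq1 : 1 <= k.+1%:R ^+ 2 :> R by rewrite -natrX ler1n expn_gt0.
  have -> : conf_int S w (Z k) = ((k.+1%:R ^+ 2) ^+ 2)^-1 *
      equi_mean S w (fun x => deviation S w B (t k) x ^+ 2).
    rewrite -(equi_meanZ hS rw)//; apply: eq_conf_int => x _.
    by rewrite /Z [_ / _]mulrC.
  rewrite lee_fin ler_pdivrMl ?exprn_gt0//.
  apply: le_trans (variance_le hS c0 D0 kappa01 rw iB (t k)) _.
  rewrite -/V; have [_ hi _] := tP k.
  apply: le_trans (ler_wpM2l V0 hi) _.
  move: sq0 sq1; set s : R := k.+1%:R ^+ 2 => sq0 sq1.
  rewrite (_ : s ^+ 2 * (2 * V * s^-1) = V * (2 * s)); last by field; rewrite gt_eqF.
  by rewrite ler_wpM2l//; lra.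
have : \forall x \ae conf S w, I01 x -> Z k x @[k --> \oo] --> 0.
  apply: (@ae_cvg0_of_summable_integrals _ _ _ _ _ _ (4 * V)).
  - exact: measurable_I01.
  - by move=> k; exact: BV_measurable.
  - move=> k x xI; rewrite mulr_ge0//; last by rewrite divr_ge0// ?sqr_ge0.
    by apply: le_trans (ltW c0) _; exact: (rf_dens_ge (rw 0%N)).
  - move=> n; rewrite big_mkord.
    apply: (@le_trans _ _ (\sum_(k < n) (2 * V * (k.+1%:R ^+ 2)^-1)%:E)%E).
      by apply: lee_sum => k _; exact: IZ.
    rewrite sumEFin lee_fin -mulr_sumr (_ : 4 * V = 2 * V * 2); last by ring.
    by rewrite ler_wpM2l ?mulr_ge0// sum_inv_squares_le.
apply: ae_mono => x Zx xI.
apply: (ratio_cvg1 (E := fun n => E n) (H := fun n => H n x) (t := t)) => //.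
- move=> i j ij; rewrite -(subnKC ij) big_split_ord/= lerDl.
  by apply: sumr_ge0 => k _; exact: p0.
- move=> i j ij; rewrite -(subnKC ij) big_split_ord/= lerDl.
  by apply: sumr_ge0 => k _; rewrite /visit indicE.
move=> e e0.
have := Zx xI => /cvgr0Pnorm_le /(_ (c * e ^+ 2)).
rewrite mulr_gt0 ?exprn_gt0// => /(_ isT).
apply: filterS => k; rewrite -deviationE /Z.
have sq0 : 0 < k.+1%:R ^+ 2 :> R by rewrite exprn_gt0.
move: sq0; set s : R := k.+1%:R ^+ 2 => sq0.
have dc : c <= dens S w x := rf_dens_ge (rw 0%N) xI.
have dx0 : 0 < dens S w x by exact: lt_le_trans c0 dc.
set y := deviation _ _ _ _ _; rewrite ger0_norm; last first.
  by rewrite mulr_ge0 ?(ltW dx0)// divr_ge0// sqr_ge0.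
move=> le1.
have : c * (y ^+ 2 / s ^+ 2) <= c * e ^+ 2.
  by apply: le_trans le1; rewrite ler_wpM2r// divr_ge0// sqr_ge0.
rewrite ler_pM2l// ler_pdivrMr ?exprn_gt0// -exprMn -(real_normK (num_real y)).
by rewrite ler_sqr ?nnegrE// mulr_ge0// ltW.
Qed.

End strong_law.

(** * Almost every fibre, and the theorem *)

Lemma ratio_cvg1_unbounded {R : realType} (E H : nat -> R) (b : R) :
  E n @[n --> \oo] --> +oo -> (E n)^-1 * H n @[n --> \oo] --> (1 : R) ->
  exists n, b < H n.
Proof.
move=> /cvgryPgt Eoo /cvgrPdist_lt /(_ 2^-1); rewrite invr_gt0 ltr0n => /(_ isT) EH.
pose a : R := Num.max 0 (2 * b).
have [n [/=]] : exists n, a < E n /\ `|1 - (E n)^-1 * H n| < 2^-1.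
  by apply: (@filter_ex _ (\oo : set_system nat)); near=> n; split; near: n; [exact: Eoo|exact: EH].
rewrite /a gt_max ltr_norml => /andP[E0 Eb] /andP[_].
rewrite ltrBlDr -ltrBlDl (_ : 1 - 2^-1 = 2^-1); last by field.
rewrite -(ltr_pM2l E0) mulVKf ?gt_eqF// => EH2; exists n.
by apply: lt_trans EH2; rewrite ltr_pdivlMr// mulrC.
Unshelve. all: by end_near.
Qed.

(** A property of almost every fibre holds along almost every whole orbit. *)
Lemma ae_orbit {d : measure_display} {T : measurableType d} {R : realType}
    (mu : {measure set T -> \bar R}) (sigma : T -> T) (P : T -> Prop) :
  measurable_fun setT sigma ->
  (forall A, measurable A -> mu (sigma @^-1` A) = mu A) ->
  (\forall w \ae mu, P w) -> \forall w \ae mu, forall n, P (iter n sigma w).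
Proof.
move=> ms inv aeP; apply: ae_foralln => n.
elim: n P aeP => [//|n ih] P aeP.
have [N [mN N0 NP]] := ih _ aeP.
exists (sigma @^-1` N); split.
- by rewrite -[_ @^-1` _]setTI; exact: ms.
- by rewrite inv.
- by move=> w /=; rewrite -iterS iterSr => nP; apply: NP.
Qed.

Section almost_every_fibre.
Context {R : realType} {d : measure_display} {W : measurableTopologicalType d}.
Variables (m : probability W R) (S : cocycle R W).
Hypothesis hS : closed_system m S.

Lemma fibre_ball_interval (p r : R) : is_interval (fibre_ball p r).
Proof.
rewrite /fibre_ball ball_itv => x y [xb xI] [yb yI] z xzy.
by split; [exact: interval_is_interval xb yb z xzy|
           exact: interval_is_interval xI yI z xzy].
Qed.

Lemma equi_meanE w (A : set R) :
  fine (equi S w A) = equi_mean S w \1_A.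
Proof.
rewrite /equi -/(Rintegral _ _ _) Rintegral_mkcondl /equi_mean /conf_int.
apply: eq_Rintegral => x _; rewrite indicE patchE.
by case: (x \in A); rewrite ?mulr1 ?mulr0.
Qed.

(** mu has a density with respect to nu. *)
Lemma equi_dominated w (P : R -> Prop) : conf S w I01 = 1%E -> BV (dens S w) ->
  (\forall x \ae conf S w, P x) -> \forall x \ae equi S w, P x.
Proof.
move=> conf1 bd [N [mN N0 NP]]; exists N; split => //.
have mNI : measurable (N `&` I01 : set (measurableTypeR R)).
  by apply: measurableI => //; exact: measurable_I01.
apply: null_set_integral => //.
  apply/measurable_EFinP.
  by apply: measurable_funS (BV_measurable bd) => //; exact: measurable_I01.
by apply: subset_measure0 N0 => //; exact: subIsetl.
Qed.

(** The essential bounds on the density and the spectral gap are uniform, so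
    that one choice of constants serves almost every orbit. *)
Lemma ae_regular_orbit : admissible m S -> exists c M D kappa,
  [/\ 0 < c, 0 < D, 0 < kappa < 1 &
      \forall w \ae m, regular_orbit S c M D kappa w].
Proof.
move=> [_ _ _ [kappa [k01 [D D0 C3] [Msup cinf _]]]].
have [c c0 cle] : exists2 c : R, 0 < c &
    (c%:E <= ess_inf m (fun w => inf01 (dens S w)))%E.
  case: ess_inf cinf => [r r0|_|//]; first by exists r.
  by exists 1 => //; rewrite leey.
have [M Mlt] : exists M : R, (ess_sup m (fun w => Bnorm S w (dens S w)) < M%:E)%E.
  case: ess_sup Msup => [r _|//|_]; last by exists 0; rewrite ltNyr.
  by exists (r + 1); rewrite lte_fin ltrDl.
exists c, M, D, kappa; split => //.
have [ms _ inv _] := cs_base hS.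
apply: (ae_orbit ms inv).
have hd := cs_dens_BV hS; have hc := cs_conformal hS.
have he := cs_eigenfunction hS; have hn := cs_dens_normalized hS.
have hM := ess_sup_ge m (fun w => Bnorm S w (dens S w)).
have hi := ess_inf_le m (fun w => inf01 (dens S w)).
near=> w; split.
- by near: w.
- move=> x xI; rewrite -lee_fin; apply: le_trans cle _.
  apply: (@le_trans _ _ (inf01 (dens S w))); first by near: w.
  by apply: ereal_inf_lbound; exists x.
- by apply: le_lt_trans Mlt; near: w.
- by near: w.
- by near: w.
- by near: w.
- by near: w.
Unshelve. all: by end_near.
Qed.

Variables (p : R) (xi : nat -> W -> R).

Lemma expected_hitsE w n :
  expected_hits S p xi w n = \sum_(k < n) visit_mean S w (target S p xi w) k.
Proof. by rewrite /expected_hits big_mkord; apply: eq_bigr => k _; rewrite equi_meanE. Qed.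

Lemma hitsE w x n :
  (hits S p xi w x n)%:R = \sum_(k < n) visit S w (target S p xi w) k x.
Proof.
rewrite /hits -sum1_card natr_sum big_mkcond/=; apply: eq_bigr => k _.
rewrite /visit indicE inE -[_ \in target _ _ _ _ _]/(`[< hit S p xi w x k >]).
by case: ifP.
Qed.

Lemma finite_hits_bounded w x : finite_set [set k | hit S p xi w x k] ->
  exists N : nat, forall n, (hits S p xi w x n <= N)%N.
Proof.
move=> /finite_seqP[s sE]; exists (size s) => n.
rewrite /hits cardE -(size_map val); apply: uniq_leq_size.
  by rewrite map_inj_uniq ?enum_uniq//; exact: val_inj.
move=> k /mapP[i]; rewrite mem_enum inE => /asboolP hi ->.
have : [set k | hit S p xi w x k] (val i) by exact: (asboolW hi).
by rewrite sE.
Qed.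

End almost_every_fibre.

Theorem proposition2p6p5 (R : realType) (d : measure_display)
    (W : measurableTopologicalType d) (m : probability W R) (S : cocycle R W)
    (hS : closed_system m S) (hadm : admissible m S)
    (p : R) (hp : I01 p) (xi : nat -> W -> R)
    (hxi_meas : forall k, measurable_fun setT (xi k))
    (hxi_pos : forall k w, 0 < xi k w)
    (hxi_desc : forall k w, xi k.+1 w < xi k w)
    (hE : \forall w \ae m, expected_hits S p xi w n @[n --> \oo] --> +oo) :
  \forall w \ae m, \forall x \ae equi S w, I01 x ->
    infinite_set [set k | hit S p xi w x k] /\
    (expected_hits S p xi w n)^-1 * (hits S p xi w x n)%:R @[n --> \oo] --> (1 : R).
Proof.
have [c [M [D [kappa [c0 D0 k01 reg]]]]] := ae_regular_orbit hS hadm.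
apply: filterS2 reg hE => w rw Eoo.
apply: equi_dominated; [exact: cs_conf_supported hS w|exact: rf_dens_BV (rw 0%N)|].
have iB k : is_interval (target S p xi w k) by exact: fibre_ball_interval.
have Eoo' : \sum_(k < n) visit_mean S w (target S p xi w) k @[n --> \oo] --> +oo.
  by under eq_fun do rewrite -expected_hitsE.
apply: ae_mono (visit_counting_law hS c0 D0 k01 rw iB Eoo') => x law xI.
have {law} ratio : (expected_hits S p xi w n)^-1 * (hits S p xi w x n)%:R
    @[n --> \oo] --> (1 : R).
  by under eq_fun do rewrite expected_hitsE hitsE; exact: law.
split => // /finite_hits_bounded[N hN].
have [n] := ratio_cvg1_unbounded N%:R Eoo ratio.
by rewrite ltr_nat ltnNge hN.
Qed.
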